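(* Assume $\mathbb E[\tanh(h)]=0$. Let $\mathcal P$ be the set of all priors on the position of the clique set $S$ (probability distributions on $\{S\subset[n]:|S|=k\}$), and let $\widehat S$ range over estimators of $S$ based on the $m$ i.i.d. samples $\{\boldsymbol\sigma^{(i)}\}_{i\in[m]}$. Then: 1. (High temperature) if $\theta_1<\frac{1}{\mathbb E[\operatorname{sech}^2(h)]}$, $\ \inf_{\widehat S}\sup_{\mathbb P\in\mathcal P}\mathbb P(S\ne\widehat S)\ge1-O\left(\frac{m}{k\log n}\right)$; 2. (Low temperature) if $\theta_1>\frac{1}{\mathbb E[\operatorname{sech}^2(h)]}$, $\ \inf_{\widehat S}\sup_{\mathbb P\in\mathcal P}\mathbb P(S\ne\widehat S)\ge1-O\left(\frac{m}{\log n}\right)$; 3. (Critical temperature) if $\theta_1=\frac{1}{\mathbb E[\operatorname{sech}^2(h)]}$ and $0$ is the global minimum of $H(x)=\frac12x^2-\mathbb E[\log\cosh(\sqrt{\theta_1}x+h)]$ with flatness $\tau$, $\ \inf_{\widehat S}\sup_{\mathbb P\in\mathcal P}\mathbb P(S\ne\widehat S)\ge1-O\left(\frac{m}{k^{\frac{1}{2\tau-1}}\log n}\right)$.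
   Context: Planted random field Curie-Weiss (pRFCW) model. Let $\mu$ be a probability measure on $\mathbb R$ with $\int|h|\,d\mu<\infty$, $h\sim\mu$, $\theta_1>0$, $[n]=\{1,\dots,n\}$, and $h_1,\dots,h_n$ i.i.d. $\sim\mu$, $\boldsymbol h=(h_1,\dots,h_n)$. For $S\subset[n]$ with $|S|=k$ define, for $\boldsymbol\sigma\in\{-1,+1\}^n$, $$\mathbb P_S(\boldsymbol\sigma\mid\boldsymbol h)\propto\exp\Big(\frac{\theta_1}{2k}\sum_{i,j\in S}\sigma_i\sigma_j+\sum_{i=1}^n h_i\sigma_i\Big)$$ (normalized) and $\mathbb P_S(\boldsymbol\sigma)=\mathbb E_{\boldsymbol h}[\mathbb P_S(\boldsymbol\sigma\mid\boldsymbol h)]$. For a prior in $\mathcal P$, the corresponding joint law $\mathbb P$ is: $S$ is drawn from the prior and, given $S$, the samples $\boldsymbol\sigma^{(1)},\dots,\boldsymbol\sigma^{(m)}$ are i.i.d. from $\mathbb P_S$ (each with its own independent field). Asymptotics: $k\to\infty$ with $n=n(k)$, $m=m(k)$; $\mu,\theta_1$ fixed; constants in $O(\cdot)$ do not depend on $n,k,m$. Flatness: a local minimum $x^*$ of $H$ is $\tau$-flat ($\tau\in\mathbb N$, $\tau\ge2$) if $H(x)=H(x^* )+\frac{H^{(2\tau)}(x^* )}{(2\tau)!}(x-x^* )^{2\tau}+O((x-x^* )^{2\tau+1})$ as $x\to x^*$ with $H^{(2\tau)}(x^* )>0$.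
   Formalization: Part 1 also assumes that 0 is the unique global minimum of H (otherwise false, e.g. h=±3 with equal probability, θ_1=10); n>k is assumed throughout, n>k+1 in part 1, and m≥1, since the bounds fail for n=k, for n=k+1 in part 1, and for m=0. *)

(* Defs.v *)
From HB Require Import structures.
From mathcomp Require Import all_boot all_order all_algebra.
From mathcomp Require Import all_classical all_reals all_analysis.

Set Implicit Arguments.
Unset Strict Implicit.
Unset Printing Implicit Defensive.

Import Order.TTheory GRing.Theory Num.Theory.
Import numFieldNormedType.Exports.

Local Open Scope classical_set_scope.
Local Open Scope ring_scope.

Section product_law.
Context {d : measure_display} {T : measurableType d} {R : realType}.

Definition tuple_cons (n : nat) (p : T * n.-tuple T) : n.+1.-tuple T :=
  [tuple of p.1 :: p.2].

Lemma measurable_tuple_cons (n : nat) :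
  measurable_fun [set: T * n.-tuple T] (@tuple_cons n).
Proof. exact: (measurable_cons measurable_fst measurable_snd). Qed.

HB.instance Definition _ (n : nat) :=
  isMeasurableFun.Build _ _ (T * n.-tuple T)%type (n.+1.-tuple T)
    (@tuple_cons n) (@measurable_tuple_cons n).

(* The law of n i.i.d. draws from mu, i.e. the n-fold product measure. *)
Fixpoint iid_law (mu : probability T R) (n : nat) :
    probability (n.-tuple T) R :=
  match n with
  | 0 => \d_([tuple] : 0.-tuple T)
  | n'.+1 =>
      distribution (mu \x iid_law mu n' : probability _ R)%E (@tuple_cons n')
  end.

End product_law.

Section hyperbolic.
Context {R : realType}.
Implicit Types x : R.

Definition cosh x : R := (expR x + expR (- x)) / 2.
Definition sinh x : R := (expR x - expR (- x)) / 2.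
Definition tanh x : R := sinh x / cosh x.
Definition sech x : R := (cosh x)^-1.

End hyperbolic.

Section pRFCW.
Context {R : realType}.
Implicit Types (mu : probability (measurableTypeR R) R) (theta : R).

(* [true] stands for +1 and [false] for -1. *)
Definition config (n : nat) : finType := {ffun 'I_n -> bool}.

Definition spin (b : bool) : R := if b then 1 else - 1.

(* The double sum includes the diagonal i = j. *)
Definition gibbs_weight (theta : R) (n : nat) (S : {set 'I_n})
    (h : n.-tuple R) (s : config n) : R :=
  expR (theta / (2 * #|S|%:R) *
          (\sum_(i in S) \sum_(j in S) spin (s i) * spin (s j))
        + \sum_(i < n) tnth h i * spin (s i)).

Definition gibbs (theta : R) (n : nat) (S : {set 'I_n})
    (h : n.-tuple R) (s : config n) : R :=
  gibbs_weight theta S h s / \sum_(t : config n) gibbs_weight theta S h t.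

Definition pRFCW mu theta (n : nat) (S : {set 'I_n}) (s : config n) : R :=
  \int[iid_law mu n]_h gibbs theta S h s.

Definition is_prior (k n : nat) (q : {ffun {set 'I_n} -> R}) : Prop :=
  [/\ forall S : {set 'I_n}, 0 <= q S,
      forall S : {set 'I_n}, #|S| != k -> q S = 0 &
      \sum_(S : {set 'I_n}) q S = 1].

Definition sample (m n : nat) : finType := {ffun 'I_m -> config n}.

Definition estimator (m n : nat) : Type := sample m n -> {set 'I_n}.

Definition joint_law mu theta (m n : nat) (q : {ffun {set 'I_n} -> R})
    (S : {set 'I_n}) (x : sample m n) : R :=
  q S * \prod_(i < m) pRFCW mu theta S (x i).

Definition error_prob mu theta (m n : nat) (q : {ffun {set 'I_n} -> R})
    (Shat : estimator m n) : R :=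
  \sum_(S : {set 'I_n}) \sum_(x : sample m n | S != Shat x)
    joint_law mu theta q S x.

(* For k <= n all sets below are nonempty and bounded, so [inf] and [sup] do not
   take their default values. *)
Definition minimax_risk mu theta (k n m : nat) : R :=
  inf [set sup [set error_prob mu theta q Shat | q in @is_prior k n]
      | Shat in [set: estimator m n]].

Definition Hfun mu theta (x : R) : R :=
  x ^+ 2 / 2 - \int[mu]_h ln (cosh (Num.sqrt theta * x + h)).

(* Strict inequality: x0 is the unique global minimiser. *)
Definition is_global_min (f : R -> R) (x0 : R) : Prop :=
  forall x, x != x0 -> f x0 < f x.

(* For f = Hfun mu theta with mu.-integrable id, f is smooth, so the total
   operator [derive1n] is the genuine iterated derivative. *)
Definition flat_local_min (f : R -> R) (x0 : R) (tau : nat) : Prop :=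
  [/\ (2 <= tau)%N,
      \forall x \near x0, f x0 <= f x,
      0 < derive1n (2 * tau) f x0 &
      (fun x => f x -
         (f x0 + derive1n (2 * tau) f x0 / (2 * tau)`!%:R * (x - x0) ^+ (2 * tau)))
        =O_ (nbhs x0) (fun x => (x - x0) ^+ (2 * tau).+1)].

End pRFCW.

(* Main.v *)
Require Import Defs.
From HB Require Import structures.
From mathcomp Require Import all_boot all_order all_algebra.
From mathcomp Require Import all_classical all_reals all_analysis.
From mathcomp Require Import measurable_realfun.
From mathcomp Require Import zify ring lra.

Set Implicit Arguments.
Unset Strict Implicit.
Unset Printing Implicit Defensive.

Import Order.TTheory GRing.Theory Num.Theory.
Import numFieldNormedType.Exports.

Local Open Scope classical_set_scope.
Local Open Scope ring_scope.

(** The three bounds come from one mechanism: swapping a bounded number of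
    sites of the clique changes the law of a sample by a Kullback-Leibler
    divergence of the order of the mean squared magnetization per site, so
    that [m] samples cannot tell apart the polynomially many swaps of a fixed
    clique [S0].

    Information part. For laws [P_S], [S] ranging over a family [F] of swaps
    of [S0], the Gibbs variational inequality [lam P(A) <= KL(P, Q) + e^lam
    Q(A)] with [Q] the law of [S0] bounds the probability of a correct guess
    by [(m max KL + e^lam / #|F|) / lam] ([fano_success]). With [lam = ln n /
    2] the second term is [sqrt n / #|F|], and it has to be at most of the
    order of the divergence: single swaps suffice when the latter is at least
    [k^(-1/2)], but at high temperature it is [1/k] and [k] may be as large as
    [n - 2], so double swaps are used there ([card_swaps], [minimax_one_swap],
    [minimax_two_swaps]).

    Divergence part. For a fixed field the two Gibbs measures differ by an
    exponential tilt whose exponent is at most a constant times the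
    magnetization per site, up to [O(1/k)], so their chi-square divergence is
    at most a multiple of the mean squared magnetization plus [1/k^2]
    ([chi2_tilt], [energy_gap_sqr_le]); joint convexity passes to the average
    over the field ([chi2_expectation], [kl_swap]). As the magnetization per
    site is at most one, this already gives the low temperature bound.

    Magnetization part. Let [k] be the clique size, [H(x) - H(0) = x^2/2 -
    Lambda(x)], and let [c x^(2 tau)] bound it from below on compact sets,
    with [tau = 1] at high temperature. Decoupling the quadratic energy with
    the grid [j / sqrt k], in place of a Gaussian variable, shows that the
    Gibbs weight near [x] is at most [exp (- k (x^2/2 - Lambda(x)) +
    (fluctuation of the field at x))] times the weight of the free spins,
    which in turn is at most the partition function. The fluctuation is at
    most [sqrt (k W) |x|] simultaneously for all grid points, where [W], the
    roughness of the field, has bounded expectation: it vanishes at [0], and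
    its first step and its second differences are centred sums of independent
    bounded variables ([discrete_sobolev], [expectation_roughness]). The field
    term therefore wins over [k x^(2 tau)] only for [x^2] below a multiple of
    [eps (1 + W)], with [k eps^(2 tau - 1) = 1], and beyond that scale the
    weights are summable with a total of order [eps] ([exponent_le],
    [tail_term_le]). Hence the mean squared magnetization is of order [eps (1
    + W)] for every field ([susceptibility_le]) and of order [eps = k^(-1/(2
    tau - 1))] on average. *)

(** * Divergences of finite laws and the testing bound *)

Section finite_information.
Context {R : realType}.

Definition is_pmf (C : finType) (P : C -> R) : Prop :=
  (forall c, 0 < P c) /\ \sum_c P c = 1.

Definition kl (C : finType) (P Q : C -> R) : R := \sum_c P c * ln (P c / Q c).

Definition chi2 (C : finType) (P Q : C -> R) : R :=
  \sum_c (P c - Q c) ^+ 2 / Q c.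

Definition iid_pmf (C : finType) (m : nat) (P : C -> R) (x : {ffun 'I_m -> C}) : R :=
  \prod_(i < m) P (x i).

Lemma ln_le_subr1 (x : R) : 0 < x -> ln x <= x - 1.
Proof.
move=> x0; have /le_ln1Dx : -1 < x - 1 by lra.
by rewrite addrC subrK.
Qed.

(** From [ln t <= t - 1] at [t = P / Q]. *)
Lemma kl_le_chi2 (C : finType) (P Q : C -> R) :
  is_pmf P -> is_pmf Q -> kl P Q <= chi2 P Q.
Proof.
move=> [P0 P1] [Q0 Q1].
rewrite -[leRHS]addr0 -[X in _ + X](subrr 1) -{1}P1 -Q1 -sumrB -big_split /=.
apply: ler_sum => c _; have Qn0 : Q c != 0 by rewrite gt_eqF.
have -> : (P c - Q c) ^+ 2 / Q c + (P c - Q c) = P c * (P c / Q c - 1) by field.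
by rewrite ler_pM2l// ln_le_subr1// divr_gt0.
Qed.

(** The Gibbs (Donsker-Varadhan) variational inequality at the test function
    [lam * 1_A]; termwise it is [ln t <= t - 1] at [t = exp (lam 1_A) Q / P]. *)
Lemma kl_event (C : finType) (P Q : C -> R) (A : pred C) (lam : R) :
  is_pmf P -> is_pmf Q ->
  lam * \sum_(c | A c) P c <= kl P Q + expR lam * \sum_(c | A c) Q c.
Proof.
move=> [P0 P1] [Q0 Q1].
have H c : lam * (if A c then P c else 0) <=
    P c * ln (P c / Q c) + expR lam * (if A c then Q c else 0) + (Q c - P c).
  set y := if A c then lam else 0.
  have E : ln (Q c * expR y / P c) = y - ln (P c / Q c).
    rewrite !ln_div ?posrE ?mulr_gt0 ?expR_gt0// lnM ?posrE ?expR_gt0// expRK; ring.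
  have := @ln_le_subr1 (Q c * expR y / P c).
  rewrite divr_gt0 ?mulr_gt0 ?expR_gt0// => /(_ isT).
  rewrite E -(ler_pM2l (P0 c)) mulrBr.
  have -> : P c * (Q c * expR y / P c - 1) = Q c * expR y - P c.
    by field; rewrite gt_eqF.
  have := Q0 c; have := expR_gt0 lam.
  by rewrite /y; case: (A c); rewrite ?expR0; lra.
rewrite (big_mkcond A) [X in _ + _ * X](big_mkcond A)/= !mulr_sumr.
rewrite -[leRHS]addr0 -[X in _ + X](subrr 1) -{1}Q1 -P1 -sumrB -!big_split /=.
by apply: ler_sum => c _; exact: H.
Qed.

Lemma ln_prod (I : Type) (r : seq I) (F : I -> R) : (forall i, 0 < F i) ->
  ln (\prod_(i <- r) F i) = \sum_(i <- r) ln (F i).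
Proof.
move=> F0; elim: r => [|i r IH]; first by rewrite !big_nil ln1.
by rewrite !big_cons lnM ?posrE ?prodr_gt0// IH.
Qed.

Lemma iid_pmf_is_pmf (C : finType) m (P : C -> R) :
  is_pmf P -> is_pmf (@iid_pmf C m P).
Proof.
move=> [P0 P1]; split=> [x|]; first by apply: prodr_gt0.
by rewrite /iid_pmf -(bigA_distr_bigA (fun _ => P)) /= big1.
Qed.

Lemma iid_pmf_marginal (C : finType) m (P : C -> R) (f : C -> R) (i : 'I_m) :
  \sum_c P c = 1 ->
  \sum_x iid_pmf P x * f (x i) = \sum_c P c * f c.
Proof.
move=> P1; pose F j c := if j == i then P c * f c else P c.
transitivity (\sum_(x : {ffun 'I_m -> C}) \prod_j F j (x j)).
  apply: eq_bigr => x _; rewrite /iid_pmf (bigD1 i)//= [RHS](bigD1 i)//= /F eqxx.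
  rewrite mulrAC; congr (_ * _); apply: eq_bigr => j /negbTE ji.
  by rewrite ji.
rewrite -(bigA_distr_bigA F) (bigD1 i)//= [X in _ * X]big1 ?mulr1.
  by apply: eq_bigr => c _; rewrite /F eqxx.
by move=> j /negbTE ji; rewrite /F ji.
Qed.

Lemma kl_iid (C : finType) m (P Q : C -> R) : is_pmf P -> is_pmf Q ->
  kl (@iid_pmf C m P) (iid_pmf Q) = m%:R * kl P Q.
Proof.
move=> [P0 P1] [Q0 Q1]; rewrite /kl.
transitivity (\sum_(x : {ffun 'I_m -> C}) \sum_(i < m)
    iid_pmf P x * ln (P (x i) / Q (x i))).
  apply: eq_bigr => x _; rewrite -mulr_sumr /iid_pmf -prodf_div ln_prod//.
  by move=> i; rewrite divr_gt0.
rewrite exchange_big/=.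
under eq_bigr => i _ do rewrite (iid_pmf_marginal (fun c => ln (P c / Q c)))//.
by rewrite sumr_const card_ord mulr_natl.
Qed.

(** Fano's method in the form [lam * p <= m D + exp lam / M]: unlike the usual
    bound, whose additive [ln 2] does not shrink with [m], the exponential term
    can be made as small as a power of [1 / M] by the choice of [lam]. *)
Lemma fano_success (C I : finType) m (P : I -> C -> R) (F : {set I}) (i0 : I)
    (D lam : R) (est : {ffun 'I_m -> C} -> I) :
  (forall i, is_pmf (P i)) -> (0 < #|F|)%N -> 0 < lam ->
  (forall i, i \in F -> kl (P i) (P i0) <= D) ->
  #|F|%:R^-1 * (\sum_(i in F) \sum_(x | est x == i) iid_pmf (P i) x)
    <= (m%:R * D + expR lam / #|F|%:R) / lam.
Proof.
move=> Pp F0 lam0 HD.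
have F0' : 0 < #|F|%:R :> R by rewrite ltr0n.
rewrite ler_pdivlMr// mulrC -(ler_pM2l F0') !mulrA.
rewrite [_ * lam]mulrC -[lam * _ * _]mulrA divff ?gt_eqF// mulr1.
rewrite mulr_sumr.
have H i : i \in F -> lam * (\sum_(x | est x == i) iid_pmf (P i) x) <=
   m%:R * D + expR lam * (\sum_(x | est x == i) @iid_pmf C m (P i0) x).
  move=> iF.
  apply: le_trans (kl_event _ _ (iid_pmf_is_pmf m (Pp i)) (iid_pmf_is_pmf m (Pp i0))) _.
  by rewrite kl_iid// lerD2r ler_wpM2l ?HD.
apply: le_trans (ler_sum _ H) _.
rewrite big_split/= sumr_const -[_ *+ _]mulr_natl -mulr_sumr mulrDr lerD2l.
have -> : #|F|%:R * (expR lam / #|F|%:R) = expR lam * 1 :> R.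
  by field; rewrite gt_eqF.
rewrite ler_pM2l ?expR_gt0//.
have [Q0 Q1] := iid_pmf_is_pmf m (Pp i0).
rewrite -[leRHS]Q1 [leRHS](partition_big est xpredT)//= big_mkcond /=.
apply: ler_sum => i _; case: ifP => // _; apply: sumr_ge0 => x _; exact: ltW.
Qed.

End finite_information.

(** * Bounded random variables and independent fields *)

Section bounded_variables.
Context {d : measure_display} {T : measurableType d} {R : realType}.
Implicit Types (P : probability T R) (f g : T -> R).

Definition bounded_rv f : Prop :=
  measurable_fun setT f /\ exists M : R, forall x, `|f x| <= M.

Lemma bounded_rv_cst (c : R) : bounded_rv (fun=> c).
Proof. by split; [exact: measurable_cst|exists `|c|]. Qed.

Lemma bounded_rvD f g : bounded_rv f -> bounded_rv g -> bounded_rv (fun x => f x + g x).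
Proof.
move=> [mf [M Mf]] [mg [N Ng]]; split; first exact: measurable_funD.
by exists (M + N) => x; rewrite (le_trans (ler_normD _ _))// lerD.
Qed.

Lemma bounded_rvM f g : bounded_rv f -> bounded_rv g -> bounded_rv (fun x => f x * g x).
Proof.
move=> [mf [M Mf]] [mg [N Ng]]; split; first exact: measurable_funM.
by exists (M * N) => x; rewrite normrM ler_pM.
Qed.

Lemma bounded_rvX f n : bounded_rv f -> bounded_rv (fun x => f x ^+ n).
Proof.
move=> bf; elim: n => [|n IH]; first exact: bounded_rv_cst.
by under eq_fun do rewrite exprS; exact: bounded_rvM.
Qed.

Lemma bounded_rvB f g : bounded_rv f -> bounded_rv g -> bounded_rv (fun x => f x - g x).
Proof.
move=> bf bg; under eq_fun do rewrite -mulN1r.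
by apply: bounded_rvD => //; apply: bounded_rvM => //; exact: bounded_rv_cst.
Qed.

Lemma bounded_rv_sum (I : Type) (r : seq I) (p : pred I) (F : I -> T -> R) :
  (forall i, bounded_rv (F i)) -> bounded_rv (fun x => \sum_(i <- r | p i) F i x).
Proof.
move=> bF; elim: r => [|i r IH].
  by under eq_fun do rewrite big_nil; exact: bounded_rv_cst.
under eq_fun do rewrite big_cons; case: (p i) => //; exact: bounded_rvD.
Qed.

Lemma bounded_rv_prod (I : Type) (r : seq I) (p : pred I) (F : I -> T -> R) :
  (forall i, bounded_rv (F i)) -> bounded_rv (fun x => \prod_(i <- r | p i) F i x).
Proof.
move=> bF; elim: r => [|i r IH].
  by under eq_fun do rewrite big_nil; exact: bounded_rv_cst.
under eq_fun do rewrite big_cons; case: (p i) => //; exact: bounded_rvM.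
Qed.

Lemma bounded_rv_integrable P f : bounded_rv f -> P.-integrable setT (EFin \o f).
Proof.
move=> [mf [M Mf]].
apply: measurable_bounded_integrable; [exact: measurableT| |exact: mf|].
  by apply: (le_lt_trans (probability_le1 P measurableT)); exact: ltry.
exists M; split; first exact: num_real.
by move=> y My x _ /=; rewrite (le_trans (Mf x))// ltW.
Qed.

Lemma expectation_cst P (c : R) : \int[P]_x c = c.
Proof. by rewrite Rintegral_cst// [X in fine X](_ : _ = 1%E) ?mulr1//; exact: probability_setT. Qed.

Lemma expectation_sum P (I : Type) (r : seq I) (p : pred I) (F : I -> T -> R) :
  (forall i, bounded_rv (F i)) ->
  \int[P]_x (\sum_(i <- r | p i) F i x) = \sum_(i <- r | p i) \int[P]_x F i x.
Proof.
move=> bF; elim: r => [|i r IH].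
  by under eq_Rintegral do rewrite big_nil; rewrite expectation_cst big_nil.
under eq_Rintegral do rewrite big_cons; rewrite big_cons -IH.
case: (p i) => //; rewrite RintegralD//; apply: bounded_rv_integrable => //.
exact: bounded_rv_sum.
Qed.

Lemma expectation_le P f g : bounded_rv f -> bounded_rv g ->
  (forall x, f x <= g x) -> \int[P]_x f x <= \int[P]_x g x.
Proof.
by move=> bf bg fg; apply: le_Rintegral => //; exact: bounded_rv_integrable.
Qed.

Lemma expectationZ P f (c : R) : bounded_rv f -> \int[P]_x (c * f x) = c * \int[P]_x f x.
Proof. by move=> bf; rewrite RintegralZl//; exact: bounded_rv_integrable. Qed.

Lemma expectationD P f g : bounded_rv f -> bounded_rv g ->
  \int[P]_x (f x + g x) = \int[P]_x f x + \int[P]_x g x.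
Proof. by move=> bf bg; rewrite RintegralD//; exact: bounded_rv_integrable. Qed.

Lemma expectationB P f g : bounded_rv f -> bounded_rv g ->
  \int[P]_x (f x - g x) = \int[P]_x f x - \int[P]_x g x.
Proof. by move=> bf bg; rewrite RintegralB//; exact: bounded_rv_integrable. Qed.

Lemma expectation_bounds P f (a b : R) : bounded_rv f ->
  (forall x, a <= f x <= b) -> a <= \int[P]_x f x <= b.
Proof.
move=> bf ab; apply/andP; split.
- rewrite -[leLHS](expectation_cst P); apply: expectation_le => //.
    exact: bounded_rv_cst.
  by move=> x; case/andP: (ab x).
- rewrite -[leRHS](expectation_cst P); apply: expectation_le => //.
    exact: bounded_rv_cst.
  by move=> x; case/andP: (ab x).
Qed.

End bounded_variables.

Lemma bounded_rv_comp d d' (T : measurableType d) (T' : measurableType d')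
    (R : realType) (phi : T -> T') (f : T' -> R) :
  measurable_fun setT phi -> bounded_rv f -> bounded_rv (fun x => f (phi x)).
Proof.
move=> mphi [mf [M Mf]]; split; first exact: (measurableT_comp mf mphi).
by exists M => x; exact: Mf.
Qed.

Section iid.
Context {d : measure_display} {T : measurableType d} {R : realType}.
Variable mu : probability T R.

Lemma bounded_rv_tnth (f : T -> R) n (i : 'I_n) :
  bounded_rv f -> bounded_rv (fun h : n.-tuple T => f (tnth h i)).
Proof. by apply: bounded_rv_comp; exact: measurable_tnth. Qed.

Lemma expectation_iidS n (a : T -> R) (b : n.-tuple T -> R)
    (F : n.+1.-tuple T -> R) :
  bounded_rv a -> bounded_rv b -> bounded_rv F ->
  (forall x t, F (tuple_cons (x, t)) = a x * b t) ->
  \int[iid_law mu n.+1]_h F h = (\int[mu]_x a x) * \int[iid_law mu n]_t b t.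
Proof.
move=> ba bb bF FE /=; rewrite /Rintegral integral_distribution/=; last 2 first.
- by apply/measurable_EFinP; exact: bF.1.
- apply: (@bounded_rv_integrable _ _ _ _ (fun z => F (tuple_cons z))).
  by apply: bounded_rv_comp => //; exact: measurable_tuple_cons.
rewrite -[RHS]/(\int[mu]_x a x * \int[iid_law mu n]_t b t).
rewrite -RintegralZr//; last exact: bounded_rv_integrable.
have intF : (mu \x iid_law mu n : probability _ R)%E.-integrable setT
    (EFin \o (fun z => F (tuple_cons z))).
  apply: bounded_rv_integrable.
  by apply: bounded_rv_comp => //; exact: measurable_tuple_cons.
rewrite [X in fine X](_ : _ = \int[mu]_x \int[iid_law mu n]_t (F (tuple_cons (x, t)))%:E)%E;
  last by rewrite (integral12_prod_meas1 intF).
rewrite /Rintegral; congr fine; apply: eq_integral => x _.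
rewrite (eq_integral (fun y => (a x * b y)%:E)); last first.
  by move=> y _; exact: (congr1 EFin (FE x y)).
rewrite -[X in _ = (_ * X)%:E]/(\int[iid_law mu n]_t b t) -expectationZ//.
rewrite /Rintegral fineK//; apply: integrable_fin_num => //.
apply: (@bounded_rv_integrable _ _ _ _ (fun t => a x * b t)).
by apply: bounded_rvM => //; exact: bounded_rv_cst.
Qed.

Lemma expectation_iid_prod n (f : 'I_n -> T -> R) : (forall i, bounded_rv (f i)) ->
  \int[iid_law mu n]_h (\prod_(i < n) f i (tnth h i)) = \prod_(i < n) \int[mu]_x f i x.
Proof.
elim: n f => [|n IH] f bf.
  by under eq_Rintegral do rewrite big_ord0; rewrite big_ord0 expectation_cst.
rewrite big_ord_recl -IH//.
apply: expectation_iidS => //.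
- by apply: bounded_rv_prod => i; exact: bounded_rv_tnth.
- by apply: bounded_rv_prod => i; exact: bounded_rv_tnth.
- move=> x t; rewrite big_ord_recl; congr (_ * _).
  by apply: eq_bigr => i _; rewrite /tuple_cons tnthS.
Qed.

Lemma expectation_iid_uncorrelated n (g : T -> R) (i j : 'I_n) : i != j ->
  bounded_rv g -> \int[mu]_x g x = 0 ->
  \int[iid_law mu n]_h (g (tnth h i) * g (tnth h j)) = 0.
Proof.
move=> ij bg g0.
pose f (l : 'I_n) x := if (l == i) || (l == j) then g x else 1.
have bf l : bounded_rv (f l).
  by rewrite /f; case: (_ || _) => //; exact: bounded_rv_cst.
transitivity (\int[iid_law mu n]_h (\prod_(l < n) f l (tnth h l))).
  apply: eq_Rintegral => h _; rewrite [RHS](bigD1 i)//= (bigD1 j) 1?eq_sym//=.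
  by rewrite /f !eqxx orbT /= big1 ?mulr1// => l /andP[/negbTE -> /negbTE ->].
rewrite expectation_iid_prod// (bigD1 i)//= [X in X * _](_ : _ = 0) ?mul0r//.
by rewrite -g0; apply: eq_Rintegral => x _; rewrite /f eqxx.
Qed.

(** The cross terms of the square are uncorrelated, so only the diagonal
    contributes. *)
Lemma expectation_iid_sum_sqr n (S : {set 'I_n}) (g : T -> R) (B : R) :
  bounded_rv g -> \int[mu]_x g x = 0 -> (forall x, `|g x| <= B) ->
  \int[iid_law mu n]_h ((\sum_(i in S) g (tnth h i)) ^+ 2) <= #|S|%:R * B ^+ 2.
Proof.
move=> bg g0 gB.
have bgi (i : 'I_n) : bounded_rv (fun h : n.-tuple T => g (tnth h i)).
  exact: bounded_rv_tnth.
under eq_Rintegral do rewrite expr2 big_distrlr /=.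
rewrite expectation_sum; last by move=> i; apply: bounded_rv_sum => j; exact: bounded_rvM.
have -> : #|S|%:R * B ^+ 2 = \sum_(i in S) B ^+ 2 by rewrite sumr_const mulr_natl.
apply: ler_sum => i iS; rewrite expectation_sum; last by move=> j; exact: bounded_rvM.
rewrite (bigD1 i)//= big1 ?addr0; last first.
  by move=> j /andP[_ ji]; apply: expectation_iid_uncorrelated => //; rewrite eq_sym.
apply: (proj2 (andP (expectation_bounds (a := 0) _ _ _))); first exact: bounded_rvM.
move=> h; rewrite -expr2 sqr_ge0/= -real_normK ?num_real// lerXn2r ?nnegrE//.
exact: le_trans (normr_ge0 _) (gB (tnth h i)).
Qed.

End iid.

(** * Elementary bounds on the exponential and on log cosh *)

Section exponential_bounds.
Context {R : realType}.
Implicit Types x s t : R.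

Lemma expRN_le_inv_sqr t : 0 < t -> expR (- t) <= 4 / t ^+ 2.
Proof.
move=> t0; have h : 1 + t / 2 <= expR (t / 2) by exact: expR_ge1Dx.
have E : expR t = expR (t / 2) * expR (t / 2).
  by rewrite -expRD; congr expR; field.
have h2 : t ^+ 2 / 4 <= expR t by rewrite E; nra.
have t2 : 0 < t ^+ 2 / 4 by rewrite divr_gt0// exprn_gt0.
rewrite expRN -[leRHS]invrK lef_pV2 ?posrE ?expR_gt0 ?invr_gt0 ?divr_gt0 ?exprn_gt0//.
by rewrite invf_div.
Qed.

(** From the cubic term on, [(n + 3)! >= 2^(n + 1)] compares the series with a
    geometric one. *)
Lemma expR_taylor2_le s : `|s| <= 1 ->
  expR s <= 1 + s + s ^+ 2 / 2 + `|s| ^+ 3.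
Proof.
move=> s1.
have H n : series (exp_coeff s) n.+3 <=
    1 + s + s ^+ 2 / 2 + `|s| ^+ 3 * (1 - 2^-1 ^+ n).
  elim: n => [|n IH].
    rewrite expr0 subrr mulr0 addr0 /series/= !big_nat_recr//= big_nil /exp_coeff /=.
    rewrite expr0 expr1 !fact0 !factS fact0 !divr1 add0r.
    by rewrite le_eqVlt; apply/orP; left; apply/eqP; field.
  rewrite seriesSr.
  have T : exp_coeff s n.+3 <= `|s| ^+ 3 * (2^-1 ^+ n * 2^-1).
    rewrite /exp_coeff /= (le_trans (ler_norm _))// normrM normrX.
    have f0 : (0 : R) < n.+3`!%:R by rewrite ltr0n fact_gt0.
    rewrite [X in _ * X]ger0_norm ?invr_ge0 ?(ltW f0)//.
    have -> : `|s| ^+ n.+3 = `|s| ^+ 3 * `|s| ^+ n by rewrite -exprD addnC addn3.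
    rewrite -mulrA ler_wpM2l ?exprn_ge0// -exprSr -[leRHS]mul1r.
    apply: ler_pM; rewrite ?exprn_ge0 ?invr_ge0 ?(ltW f0)//; first exact: exprn_ile1.
    rewrite exprVn lef_pV2 ?posrE ?exprn_gt0// -natrX ler_nat.
    elim: n {IH f0} => // n IH; rewrite expnS factS leq_mul//.
  apply: le_trans (lerD IH T) _; rewrite [2^-1 ^+ n.+1]exprSr.
  by rewrite -addrA -mulrDr lerD2l ler_wpM2l ?exprn_ge0//; lra.
have cvg := is_cvg_series_exp_coeff s.
apply: limr_le => //; near=> n.
have n3 : (3 <= n)%N by near: n; exists 3%N.
have -> : n = (n - 3).+3 by lia.
apply: le_trans (H _) _; rewrite lerD2l ler_piMr ?exprn_ge0//.
Unshelve. all: by end_near. Qed.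

End exponential_bounds.

Section log_cosh.
Context {R : realType}.
Implicit Types x y d h t : R.

Lemma cosh_gt0 y : 0 < cosh y.
Proof. by rewrite /cosh divr_gt0// addr_gt0// expR_gt0. Qed.

Lemma coshD y d : cosh (y + d) = cosh y * cosh d + sinh y * sinh d.
Proof. by rewrite /cosh /sinh opprD !expRD; field. Qed.

Lemma coshB y d : cosh (y - d) = cosh y * cosh d - sinh y * sinh d.
Proof. by rewrite /cosh /sinh opprD !expRD opprK; field. Qed.

Lemma cosh2_sinh2 y : cosh y ^+ 2 - sinh y ^+ 2 = 1.
Proof.
rewrite -[RHS](expRxMexpNx_1 y) /cosh /sinh; by field.
Qed.

Lemma sech2_tanh2 y : sech y ^+ 2 = 1 - tanh y ^+ 2.
Proof.
have c0 : cosh y != 0 by rewrite gt_eqF ?cosh_gt0.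
rewrite /sech /tanh expr_div_n exprVn -[in RHS](divff (x := cosh y ^+ 2)) ?expf_neq0//.
by rewrite -mulrBl cosh2_sinh2 mul1r.
Qed.

Lemma cosh_ge1 y : 1 <= cosh y.
Proof. by have := cosh2_sinh2 y; have := cosh_gt0 y; nra. Qed.

Lemma tanh_norm_le1 y : `|tanh y| <= 1.
Proof.
rewrite -[leRHS]normr1 -ler_sqr ?nnegrE// !real_normK ?num_real// expr1n.
rewrite -subr_ge0 -sech2_tanh2 sqr_ge0 //.
Qed.

(** The log partition function of one spin in the field [y], up to [ln 2]. *)
Definition lncosh y : R := ln (cosh y).

Lemma coshD_le y d : cosh (y + d) <= cosh y * expR `|d|.
Proof.
rewrite /cosh opprD !expRD mulrAC ler_pM2r ?invr_gt0//.
have a := expR_gt0 y; have b := expR_gt0 (- y).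
have c : expR d <= expR `|d| by rewrite ler_expR ler_norm.
have e : expR (- d) <= expR `|d| by rewrite ler_expR -normrN ler_norm.
by nra.
Qed.

Lemma lncoshD_le y d : lncosh (y + d) <= lncosh y + `|d|.
Proof.
rewrite /lncosh -[X in _ <= _ + X]expRK -lnM ?posrE ?cosh_gt0 ?expR_gt0//.
have a := cosh_gt0 (y + d); have b := cosh_gt0 y; have c := expR_gt0 `|d|.
have bc : 0 < cosh y * expR `|d| by exact: mulr_gt0.
by rewrite ler_ln ?posrE//; exact: coshD_le.
Qed.

Lemma lncosh_lip y d : `|lncosh (y + d) - lncosh y| <= `|d|.
Proof.
have a := lncoshD_le y d; have := lncoshD_le (y + d) (- d).
by rewrite addrK normrN => b; rewrite ler_norml; apply/andP; split; lra.
Qed.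

Lemma lncosh_norm_le y : `|lncosh y| <= `|y|.
Proof.
have := lncosh_lip 0 y; rewrite add0r /lncosh.
have -> : cosh 0 = 1 :> R by rewrite /cosh oppr0 expR0; field.
by rewrite ln1 subr0.
Qed.

Lemma sinh_norm_le d : `|sinh d| <= `|d| * expR `|d|.
Proof.
have key e : 0 <= e -> sinh e <= e * expR e.
  move=> e0; rewrite /sinh.
  have a := expR_ge1Dx (- (2 * e)); have b := expR_gt0 e.
  have E : expR (- e) = expR e * expR (- (2 * e)) by rewrite -expRD; congr expR; ring.
  by rewrite E; nra.
have [d0|/ltW d0] := leP 0 d.
  rewrite [X in X * expR X]ger0_norm// ger0_norm ?key//.
  by rewrite /sinh divr_ge0// subr_ge0 ler_expR; lra.
rewrite [X in X * expR X]ler0_norm//.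
have -> : `|sinh d| = sinh (- d).
  rewrite /sinh opprK ler0_norm ?mulrN -?mulNr ?opprB//.
  by rewrite mulr_le0_ge0 ?invr_ge0// subr_le0 ler_expR; lra.
by apply: key; lra.
Qed.

(** Since [cosh (y + d) cosh (y - d) = cosh^2 y + sinh^2 d], the second
    difference of [lncosh] is [ln (1 + sinh^2 d / cosh^2 y)]. *)
Lemma lncosh_second_diff y d : `|d| <= 1 ->
  `|lncosh (y + d) - 2 * lncosh y + lncosh (y - d)| <= expR 2 * d ^+ 2.
Proof.
move=> d1; have c0 := cosh_gt0 y.
have c2 : 0 < cosh y ^+ 2 by rewrite exprn_gt0.
have E : lncosh (y + d) - 2 * lncosh y + lncosh (y - d) =
    ln (1 + sinh d ^+ 2 / cosh y ^+ 2).
  have -> : 1 + sinh d ^+ 2 / cosh y ^+ 2 = cosh (y + d) * cosh (y - d) / cosh y ^+ 2.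
    rewrite -[1](divff (x := cosh y ^+ 2)) ?gt_eqF// -mulrDl coshD coshB; congr (_ / _).
    have := cosh2_sinh2 d; have := cosh2_sinh2 y.
    move=> e1 e2.
    have -> : cosh y ^+ 2 + sinh d ^+ 2 =
      cosh y ^+ 2 * 1 + sinh d ^+ 2 * 1 by ring.
    by rewrite -{1}e2 -e1; ring.
  have a := cosh_gt0 (y + d); have b := cosh_gt0 (y - d).
  have ab : 0 < cosh (y + d) * cosh (y - d) by exact: mulr_gt0.
  rewrite ln_div ?posrE// lnM ?posrE// lnXn// /lncosh -mulr_natl; ring.
have q0 : 0 <= sinh d ^+ 2 / cosh y ^+ 2 by rewrite divr_ge0 ?sqr_ge0.
rewrite E ger0_norm ?ln_ge0 ?lerDl//.
apply: le_trans (le_ln1Dx _) _; first by lra.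
have -> : expR 2 * d ^+ 2 = (`|d| * expR 1) ^+ 2.
  rewrite exprMn real_normK ?num_real// mulrC; congr (_ * _).
  by rewrite expr2 -expRD; congr expR; ring.
apply: (@le_trans _ _ (sinh d ^+ 2)).
  rewrite ler_piMr ?sqr_ge0// invf_le1// -[1](expr1n _ 2).
  by rewrite lerXn2r ?nnegrE ?(ltW c0) ?cosh_ge1.
rewrite -[leLHS]real_normK ?num_real// lerXn2r ?nnegrE ?mulr_ge0 ?expR_ge0//.
by apply: le_trans (sinh_norm_le d) _; rewrite ler_wpM2l// ler_expR.
Qed.

(** With [t = tanh h], [cosh (y + h) / cosh h = e^(t y) w] where
    [w = (1+t)/2 e^((1-t) y) + (1-t)/2 e^(-(1+t) y)]; then [ln w <= w - 1], whose
    first order term cancels. *)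
Lemma lncosh_taylor y h : `|y| <= 2^-1 ->
  lncosh (y + h) - lncosh h <= y * tanh h + y ^+ 2 / 2 * sech h ^+ 2 + 16 * `|y| ^+ 3.
Proof.
move=> y1; have c0 := cosh_gt0 h.
set t := tanh h; have /ler_normlP[t1 t2] := tanh_norm_le1 h; rewrite -/t in t1 t2.
have E : cosh (y + h) / cosh h =
    expR (t * y) * ((1 + t) / 2 * expR ((1 - t) * y) + (1 - t) / 2 * expR (- (1 + t) * y)).
  rewrite coshD mulrDl mulfK ?gt_eqF// -mulrA -/(tanh h) -/t mulrDr !(mulrCA (expR _)).
  rewrite -!expRD; have -> : t * y + (1 - t) * y = y by ring.
  have -> : t * y + - (1 + t) * y = - y by ring.
  by rewrite /cosh /sinh; field.
set w := (X in _ = expR _ * X) in E.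
have w0 : 0 < w.
  by rewrite -(pmulr_rgt0 _ (expR_gt0 (t * y))) -E divr_gt0 ?cosh_gt0.
have -> : lncosh (y + h) - lncosh h = t * y + ln w.
  rewrite /lncosh -ln_div ?posrE ?cosh_gt0// E lnM ?posrE ?expR_gt0//.
  by rewrite expRK.
have tay s : `|s| <= 2 -> expR (s * y) <= 1 + s * y + (s * y) ^+ 2 / 2 + 8 * `|y| ^+ 3.
  move=> s2; have sy : `|s * y| <= 1.
    by rewrite normrM -[leRHS](mulfV (x := 2))// ler_pM.
  apply: le_trans (expR_taylor2_le sy) _; rewrite lerD2l normrM exprMn.
  rewrite ler_wpM2r ?exprn_ge0// -[8](_ : 2 ^+ 3 = _); first by rewrite lerXn2r ?nnegrE.
  by ring.
have h1 : `|1 - t| <= 2 by rewrite ler_norml; lra.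
have h2 : `|- (1 + t)| <= 2 by rewrite ler_norml; lra.
have := tay _ h1; have := tay _ h2.
have y3 : 0 <= `|y| ^+ 3 by rewrite exprn_ge0.
rewrite sech2_tanh2 -/t => b a.
have lw : ln w <= w - 1.
  have /le_ln1Dx : -1 < w - 1 by lra.
  by rewrite addrC subrK.
suff : w - 1 <= y ^+ 2 / 2 * (1 - t ^+ 2) + 16 * `|y| ^+ 3 by lra.
have : w <= (1 + t) / 2 * (1 + (1 - t) * y + ((1 - t) * y) ^+ 2 / 2 + 8 * `|y| ^+ 3) +
   (1 - t) / 2 * (1 + - (1 + t) * y + (- (1 + t) * y) ^+ 2 / 2 + 8 * `|y| ^+ 3).
  by rewrite lerD// ler_wpM2l// divr_ge0//; lra.
move=> /le_trans; rewrite lerBlDr; apply.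
set z := `|y| ^+ 3 in y3 *; nra.
Qed.

End log_cosh.

(** * The mean free energy and its coercivity *)

Section free_energy.
Context {R : realType}.
Variables (mu : probability (measurableTypeR R) R) (theta : R).
Let rt := Num.sqrt theta.

(** The gain in the log partition function of one spin in the field [h] when the
    order parameter [x] is switched on; [Lambda] is its mean, so that
    [H x - H 0 = x^2/2 - Lambda x]. *)
Definition lncosh_shift (x h : R) : R := lncosh (Num.sqrt theta * x + h) - lncosh h.

Definition Lambda (x : R) : R := \int[mu]_h lncosh_shift x h.

Lemma lncosh_shift0 h : lncosh_shift 0 h = 0.
Proof. by rewrite /lncosh_shift mulr0 add0r subrr. Qed.

Lemma Lambda0 : Lambda 0 = 0.
Proof.
by rewrite /Lambda; under eq_Rintegral do rewrite lncosh_shift0; rewrite expectation_cst.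
Qed.

Lemma lncosh_shift_lip x y h :
  `|lncosh_shift x h - lncosh_shift y h| <= rt * `|x - y|.
Proof.
have -> : lncosh_shift x h - lncosh_shift y h =
    lncosh ((rt * y + h) + rt * (x - y)) - lncosh (rt * y + h).
  have -> : rt * y + h + rt * (x - y) = rt * x + h by ring.
  by rewrite /lncosh_shift -/rt; ring.
by apply: le_trans (lncosh_lip _ _) _; rewrite normrM ger0_norm ?sqrtr_ge0.
Qed.

Lemma lncosh_shift_norm_le x h : `|lncosh_shift x h| <= rt * `|x|.
Proof. by have := lncosh_shift_lip x 0 h; rewrite lncosh_shift0 !subr0. Qed.

Lemma measurable_lncosh : measurable_fun setT (@lncosh R).
Proof.
apply: measurableT_comp; first exact: measurable_ln.
apply: measurable_funM; last exact: measurable_cst.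
apply: measurable_funD; first exact: measurable_expR.
by apply: measurableT_comp; [exact: measurable_expR|exact: measurable_funN].
Qed.

Lemma bounded_rv_lncosh_shift x :
  @bounded_rv _ (measurableTypeR R) R (lncosh_shift x).
Proof.
split; last by exists (rt * `|x|) => h; exact: lncosh_shift_norm_le.
apply: measurable_funB; last exact: measurable_lncosh.
apply: (measurableT_comp measurable_lncosh).
by apply: measurable_funD; first exact: measurable_cst.
Qed.

Lemma Lambda_lip x y : `|Lambda x - Lambda y| <= rt * `|x - y|.
Proof.
rewrite -expectationB; try exact: bounded_rv_lncosh_shift.
rewrite ler_norml; apply: expectation_bounds.
  by apply: bounded_rvB; exact: bounded_rv_lncosh_shift.
by move=> h; rewrite -ler_norml lncosh_shift_lip.
Qed.

Lemma integrable_lncosh : mu.-integrable [set: measurableTypeR R] (fun h => h%:E) ->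
  mu.-integrable [set: measurableTypeR R] (EFin \o @lncosh R).
Proof.
move=> ih; apply: le_integrable ih => //.
  by apply/measurable_EFinP; exact: measurable_lncosh.
by move=> h _ /=; rewrite lee_fin lncosh_norm_le.
Qed.

Lemma Hfun_Lambda x : mu.-integrable [set: measurableTypeR R] (fun h => h%:E) ->
  Hfun mu theta x - Hfun mu theta 0 = x ^+ 2 / 2 - Lambda x.
Proof.
move=> ih; have il := integrable_lncosh ih.
have E y : Hfun mu theta y = y ^+ 2 / 2 - (Lambda y + \int[mu]_h lncosh h).
  rewrite /Hfun /Lambda -RintegralD//; last first.
    by apply: bounded_rv_integrable; exact: bounded_rv_lncosh_shift.
  by congr (_ - _); apply: eq_Rintegral => h _; rewrite /lncosh_shift subrK.
rewrite !E Lambda0; ring.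
Qed.

(** Lipschitz continuity of [Lambda] and compactness extend a lower bound near the
    minimiser to any bounded interval. *)
Lemma coercive_extend p : (forall x, x != 0 -> 0 < x ^+ 2 / 2 - Lambda x) ->
  (exists2 c : R, 0 < c & exists2 r : R, 0 < r &
     forall x, `|x| < r -> c * `|x| ^+ p <= x ^+ 2 / 2 - Lambda x) ->
  forall X : R, 0 < X -> exists2 c : R, 0 < c &
     forall x, `|x| <= X -> c * `|x| ^+ p <= x ^+ 2 / 2 - Lambda x.
Proof.
move=> pos [c c0 [r r0 loc]] X X0.
pose f (s x : R) := (s * x) ^+ 2 / 2 - Lambda (s * x).
have contL : continuous Lambda.
  move=> x; apply/cvgrPdist_le => e e0.
  have d0 : 0 < e / (rt + 1) by rewrite divr_gt0// ltr_wpDl ?sqrtr_ge0.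
  near=> y; apply: le_trans (Lambda_lip _ _) _.
  have : `|x - y| <= e / (rt + 1).
    by near: y; exact: cvgr_dist_le.
  rewrite ler_pdivlMr ?ltr_wpDl ?sqrtr_ge0// => h; apply: le_trans h.
  by rewrite mulrC ler_wpM2l// lerDl.
have contf s : continuous (f s).
  move=> x; apply: cvgB.
    apply: cvgMl; rewrite expr2; under eq_fun do rewrite expr2.
    by apply: cvgM; apply: cvgMr; exact: cvg_id.
  apply: (@continuous_comp _ _ _ (fun x => s * x) Lambda); last exact: contL.
  by apply: cvgMr; exact: cvg_id.
(* Half the radius: the local bound is stated on an open ball. *)
pose r' := Num.min (r / 2) X.
have r'0 : 0 < r' by rewrite lt_min divr_gt0.
have r'X : r' <= X by rewrite ge_min lexx orbT.
have r'r : r' < r by rewrite gt_min; apply/orP; left; lra.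
have far s : s != 0 -> exists2 m : R, 0 < m & forall x, r' <= x <= X -> m <= f s x.
  move=> s0; have [z zI zmin] := @EVT_min R (f s) r' X r'X (continuous_subspaceT (contf s)).
  exists (f s z); last by move=> x xI; apply: zmin; rewrite in_itv/=.
  apply: pos; rewrite mulf_neq0//.
  by move: zI; rewrite in_itv/= => /andP[+ _]; move=> /(lt_le_trans r'0); rewrite lt0r => /andP[].
have [m1 m10 f1] := far 1 (oner_neq0 _).
have N1 : -1 != 0 :> R by rewrite oppr_eq0 oner_neq0.
have [m2 m20 f2] := far (-1) N1.
exists (Num.min c (Num.min m1 m2 / X ^+ p)).
  by rewrite lt_min c0 divr_gt0 ?exprn_gt0// lt_min m10.
move=> x xX; have [xr|rx] := ltP `|x| r'.
  apply: le_trans (loc x (lt_trans xr r'r)).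
  by rewrite ler_wpM2r ?exprn_ge0// ge_min lexx.
have : Num.min m1 m2 <= x ^+ 2 / 2 - Lambda x.
  have I : r' <= `|x| <= X by rewrite rx.
  have := f1 _ I; have := f2 _ I; rewrite /f mul1r mulN1r.
  rewrite ge_min; have [x0|x0] := leP 0 x => h2 h1.
    by rewrite -[x]ger0_norm// h1.
  have -> : x = - `|x| by rewrite ltr0_norm ?opprK.
  by rewrite h2 orbT.
apply: le_trans; apply: (@le_trans _ _ (Num.min m1 m2 / X ^+ p * `|x| ^+ p)).
  by rewrite ler_wpM2r ?exprn_ge0// ge_min lexx orbT.
rewrite mulrAC ler_pdivrMr ?exprn_gt0//; apply: ler_wpM2l.
  by rewrite ltW// lt_min m10.
by rewrite lerXn2r ?nnegrE ?(ltW X0).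
Unshelve. all: by end_near. Qed.

Lemma global_min_Lambda :
  mu.-integrable [set: measurableTypeR R] (fun h => h%:E) ->
  is_global_min (Hfun mu theta) 0 -> forall x, x != 0 -> 0 < x ^+ 2 / 2 - Lambda x.
Proof. by move=> ih gm x x0; rewrite -Hfun_Lambda// subr_gt0 gm. Qed.

End free_energy.

Section local_curvature.
Context {R : realType}.
Variables (mu : probability (measurableTypeR R) R) (theta : R).
Hypothesis theta_gt0 : 0 < theta.

Lemma bounded_rv_tanh : @bounded_rv _ (measurableTypeR R) R tanh.
Proof.
split; last by exists 1 => h; exact: tanh_norm_le1.
have -> : @tanh R = fun h => sinh h * expR (- lncosh h).
  by apply/funext => h; rewrite /tanh expRN lnK ?posrE ?cosh_gt0.
apply: measurable_funM.
  apply: measurable_funM; last exact: measurable_cst.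
  apply: measurable_funB; first exact: measurable_expR.
  by apply: measurableT_comp; [exact: measurable_expR|exact: measurable_funN].
apply: measurableT_comp; first exact: measurable_expR.
by apply: measurable_funN; exact: measurable_lncosh.
Qed.

Lemma bounded_rv_sech2 : @bounded_rv _ (measurableTypeR R) R (fun h => sech h ^+ 2).
Proof.
under eq_fun do rewrite sech2_tanh2.
apply: bounded_rvB; first exact: bounded_rv_cst.
by apply: bounded_rvX; exact: bounded_rv_tanh.
Qed.

(** The first order term averages out since [tanh] is centred. *)
Lemma Lambda_taylor x : \int[mu]_h tanh h = 0 -> Num.sqrt theta * `|x| <= 2^-1 ->
  Lambda mu theta x <= theta * x ^+ 2 / 2 * \int[mu]_h (sech h ^+ 2)
    + 16 * (Num.sqrt theta * `|x|) ^+ 3.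
Proof.
move=> t0 x1; set s := Num.sqrt theta in x1 *.
have s2 : s ^+ 2 = theta by rewrite sqr_sqrtr// ltW.
have sx : `|s * x| = s * `|x| by rewrite normrM ger0_norm ?sqrtr_ge0.
have bt := bounded_rv_tanh; have bs := bounded_rv_sech2.
have bc (c : R) : @bounded_rv _ (measurableTypeR R) R (fun=> c) by exact: bounded_rv_cst.
have -> : theta * x ^+ 2 / 2 * \int[mu]_h (sech h ^+ 2) + 16 * (s * `|x|) ^+ 3 =
  \int[mu]_h (s * x * tanh h + (s * x) ^+ 2 / 2 * sech h ^+ 2 + 16 * `|s * x| ^+ 3).
  rewrite !expectationD//; try exact: bounded_rvM; last first.
    by apply: bounded_rvD; exact: bounded_rvM.
  by rewrite !expectationZ// t0 expectation_cst mulr0 add0r [(s * x) ^+ 2]exprMn s2 sx.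
apply: expectation_le => //; first exact: bounded_rv_lncosh_shift.
  by apply: bounded_rvD => //; apply: bounded_rvD; exact: bounded_rvM.
by move=> h; apply: lncosh_taylor; rewrite sx.
Qed.

Lemma local_curvature_high_temp : \int[mu]_h tanh h = 0 ->
  theta < 1 / \int[mu]_h (sech h ^+ 2) ->
  exists2 c : R, 0 < c & exists2 r : R, 0 < r &
     forall x, `|x| < r -> c * `|x| ^+ 2 <= x ^+ 2 / 2 - Lambda mu theta x.
Proof.
move=> t0; set I := \int[mu]_h _ => thI.
have I0 : 0 <= I by apply: Rintegral_ge0 => h _; exact: sqr_ge0.
have Igt0 : 0 < I.
  rewrite lt0r I0 andbT; apply/eqP => IE; move: thI.
  by rewrite IE invr0 mulr0 ltNge ltW.
have a0 : 0 < 1 - theta * I by move: thI; rewrite ltr_pdivlMr//; lra.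
set a := 1 - theta * I in a0.
have a1 : a <= 1 by rewrite gerBl mulr_ge0// ltW.
set s := Num.sqrt theta; have s0 : 0 <= s by exact: sqrtr_ge0.
have s1 : 1 <= s + 1 by lra.
have s3 : 1 <= (s + 1) ^+ 3 by exact: exprn_ege1.
exists (a / 4); first by rewrite divr_gt0.
(* This radius keeps the cubic remainder below [a x^2 / 4]. *)
exists (a / (64 * (s + 1) ^+ 3)).
  by rewrite divr_gt0// mulr_gt0// exprn_gt0//; lra.
move=> x; rewrite ltr_pdivlMr; last by rewrite mulr_gt0// exprn_gt0//; lra.
have x0 := normr_ge0 x; have -> : `|x| ^+ 2 = x ^+ 2 by rewrite real_normK ?num_real.
move=> xr.
have le3 : s <= (s + 1) ^+ 3.
  have : s + 1 <= (s + 1) ^+ 3 by rewrite ler_eXnr.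
  by lra.
have sx : s * `|x| <= 2^-1.
  have : s * `|x| <= (s + 1) ^+ 3 * `|x| by rewrite ler_wpM2r.
  by lra.
have s33 : s ^+ 3 <= (s + 1) ^+ 3 by rewrite lerXn2r ?nnegrE//; lra.
have := Lambda_taylor t0 sx; rewrite -/I -/s exprMn.
have -> : `|x| ^+ 3 = x ^+ 2 * `|x|.
  by rewrite exprSr real_normK ?num_real.
have : 16 * (s ^+ 3 * (x ^+ 2 * `|x|)) <= x ^+ 2 * (a / 4).
  have -> : 16 * (s ^+ 3 * (x ^+ 2 * `|x|)) = x ^+ 2 * (16 * (s ^+ 3 * `|x|)) by ring.
  rewrite ler_wpM2l ?sqr_ge0//.
  have : s ^+ 3 * `|x| <= (s + 1) ^+ 3 * `|x| by rewrite ler_wpM2r.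
  lra.
have -> : theta * x ^+ 2 / 2 * I = x ^+ 2 / 2 - x ^+ 2 / 2 * a by rewrite /a; field.
by lra.
Qed.

(** Within the radius [a / (2 k)] the remainder of order [2 tau + 1] takes at most
    half of the leading term. *)
Lemma local_curvature_flat tau :
  mu.-integrable [set: measurableTypeR R] (fun h => h%:E) ->
  flat_local_min (Hfun mu theta) 0 tau ->
  exists2 c : R, 0 < c & exists2 r : R, 0 < r &
     forall x, `|x| < r -> c * `|x| ^+ (2 * tau) <= x ^+ 2 / 2 - Lambda mu theta x.
Proof.
move=> ih [tau2 _]; set D := derive1n _ _ _ => D0 /eqO_exP[k k0].
set a := D / _ => H.
have a0 : 0 < a by rewrite divr_gt0// ltr0n fact_gt0.
exists (a / 2); first by rewrite divr_gt0.
have [r /= r0 Hr] := H.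
exists (Num.min r (a / (2 * k))).
  by rewrite lt_min r0 divr_gt0// mulr_gt0.
move=> x; rewrite lt_min => /andP[xr]; rewrite ltr_pdivlMr ?mulr_gt0// => xk.
have /= := Hr x; rewrite /ball_ /= sub0r normrN => /(_ xr).
rewrite !subr0 -Hfun_Lambda// normrX.
have -> : x ^+ (2 * tau) = `|x| ^+ (2 * tau) by rewrite !exprM real_normK ?num_real.
rewrite exprS; set z := `|x| ^+ (2 * tau).
have z0 : 0 <= z by exact: exprn_ge0.
have : k * (`|x| * z) <= a / 2 * z.
  by rewrite mulrA ler_wpM2r//; lra.
rewrite ler_norml => h /andP[h1 _]; lra.
Qed.

End local_curvature.

(** * Comparison of Gibbs measures *)

Section chi2_comparison.
Context {R : realType}.

Lemma expR_subr1_le (f B : R) : `|f| <= B -> `|expR f - 1| <= `|f| * expR B.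
Proof.
move=> fB; have B0 : 0 <= B by exact: le_trans (normr_ge0 f) fB.
have eB1 : 1 <= expR B by rewrite -expR0 ler_expR.
have f1 := expR_ge1Dx f; have f2 := expR_ge1Dx (- f).
have ef := expR_gt0 f; have efN := expRxMexpNx_1 f.
have [f0|/ltW f0] := leP 0 f.
  rewrite !ger0_norm//; last by rewrite subr_ge0 -expR0 ler_expR.
  have : expR f <= expR B by rewrite ler_expR (le_trans _ fB)// ler_norm.
  by nra.
rewrite [X in X * _]ler0_norm// ler0_norm; last by rewrite subr_le0 -expR0 ler_expR.
by nra.
Qed.

(** Tilting [Q] by [e^f]: the chi-square divergence is the relative variance of
    [e^f] under [Q]. *)
Lemma chi2_tilt (C : finType) (Q f : C -> R) (B : R) : is_pmf Q ->
  (forall c, `|f c| <= B) ->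
  chi2 (fun c => Q c * expR (f c) / (\sum_a Q a * expR (f a))) Q
    <= expR (4 * B) * \sum_c Q c * f c ^+ 2.
Proof.
move=> [Q0 Q1] fB; set W := \sum_a _.
have WB : expR (- B) <= W.
  rewrite -[leLHS]mul1r -Q1 mulr_suml; apply: ler_sum => c _.
  rewrite ler_pM2l// ler_expR lerNl; apply: le_trans (fB c).
  by rewrite -normrN ler_norm.
have W0 : 0 < W by apply: lt_le_trans WB; exact: expR_gt0.
have -> : chi2 (fun c => Q c * expR (f c) / W) Q =
    (\sum_c Q c * (expR (f c) - W) ^+ 2) / W ^+ 2.
  rewrite /chi2 mulr_suml; apply: eq_bigr => c _; field.
  by rewrite !gt_eqF.
have V : \sum_c Q c * (expR (f c) - W) ^+ 2 <= \sum_c Q c * (expR (f c) - 1) ^+ 2.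
  have sq a : \sum_c Q c * (expR (f c) - a) ^+ 2 =
      \sum_c Q c * expR (f c) ^+ 2 - 2 * a * W + a ^+ 2.
    have -> : a ^+ 2 = \sum_c Q c * a ^+ 2 by rewrite -mulr_suml Q1 mul1r.
    rewrite /W -mulNr mulr_sumr -!big_split/=.
    by apply: eq_bigr => c _; ring.
  have -> : \sum_c Q c * (expR (f c) - 1) ^+ 2 =
     \sum_c Q c * (expR (f c) - W) ^+ 2 + (W - 1) ^+ 2 by rewrite !sq; ring.
  by rewrite lerDl sqr_ge0.
rewrite ler_pdivrMr ?exprn_gt0//; apply: le_trans V _.
have WB2 : expR (- B) ^+ 2 <= W ^+ 2 by rewrite lerXn2r ?nnegrE ?expR_ge0// ltW.
have S0 : 0 <= \sum_c Q c * f c ^+ 2.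
  by apply: sumr_ge0 => c _; rewrite mulr_ge0 ?sqr_ge0// ltW.
apply: (@le_trans _ _ (expR (2 * B) * \sum_c Q c * f c ^+ 2)); last first.
  rewrite [leRHS]mulrAC ler_wpM2r//.
  have <- : expR (4 * B) * expR (- B) ^+ 2 = expR (2 * B).
    by rewrite expr2 -!expRD; congr expR; ring.
  by rewrite ler_wpM2l ?expR_ge0.
rewrite mulr_sumr; apply: ler_sum => c _; rewrite [leRHS]mulrCA ler_pM2l//.
have -> : expR (2 * B) * f c ^+ 2 = (`|f c| * expR B) ^+ 2.
  rewrite exprMn real_normK ?num_real// mulrC; congr (_ * _).
  by rewrite expr2 -expRD; congr expR; ring.
rewrite -[leLHS]real_normK ?num_real// lerXn2r ?nnegrE ?mulr_ge0 ?expR_ge0//.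
exact: expR_subr1_le.
Qed.

(** Joint convexity of the chi-square divergence, through
    [x^2 / y = max_c (2 c x - c^2 y)] with [c] frozen at the value that is
    optimal for the averaged laws. *)
Lemma chi2_expectation d (T : measurableType d) (P : probability T R) (C : finType)
    (g g' : C -> T -> R) (U : T -> R) :
  (forall c, bounded_rv (g c)) -> (forall c, bounded_rv (g' c)) -> bounded_rv U ->
  (forall c h, 0 < g' c h) -> (forall c, 0 < \int[P]_h g' c h) ->
  (forall h, chi2 (g ^~ h) (g' ^~ h) <= U h) ->
  chi2 (fun c => \int[P]_h g c h) (fun c => \int[P]_h g' c h) <= \int[P]_h U h.
Proof.
move=> bg bg' bU g'0 Q0 HU.
pose p c := \int[P]_h g c h; pose q c := \int[P]_h g' c h.
pose k c := (p c - q c) / q c.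
have bk c : bounded_rv (fun h => 2 * k c * (g c h - g' c h) - k c ^+ 2 * g' c h).
  apply: bounded_rvB; apply: bounded_rvM; try exact: bounded_rv_cst => //.
    exact: bounded_rvB.
  exact: bg'.
have -> : chi2 p q = \int[P]_h (\sum_c (2 * k c * (g c h - g' c h) - k c ^+ 2 * g' c h)).
  rewrite expectation_sum//; apply: eq_bigr => c _.
  rewrite expectationB; last 2 first.
  - by apply: bounded_rvM; [exact: bounded_rv_cst|exact: bounded_rvB].
  - by apply: bounded_rvM; [exact: bounded_rv_cst|exact: bg'].
  rewrite !expectationZ ?expectationB//; last exact: bounded_rvB.
  by rewrite -/(p c) -/(q c) /k; field; rewrite gt_eqF// Q0.
apply: expectation_le => //; first exact: bounded_rv_sum.
move=> h; apply: le_trans (HU h); apply: ler_sum => c _.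
rewrite -subr_ge0; have y0 := g'0 c h.
have -> : (g c h - g' c h) ^+ 2 / g' c h -
    (2 * k c * (g c h - g' c h) - k c ^+ 2 * g' c h) =
    (g c h - g' c h - k c * g' c h) ^+ 2 / g' c h by field; rewrite gt_eqF.
by rewrite divr_ge0 ?sqr_ge0// ltW.
Qed.

(** A nonnegative function with zero integral vanishes almost everywhere. *)
Lemma expectation_gt0 d (T : measurableType d) (P : probability T R) (f : T -> R) :
  bounded_rv f -> (forall h, 0 < f h) -> 0 < \int[P]_h f h.
Proof.
move=> bf f0; rewrite lt0r Rintegral_ge0 ?andbT; last by move=> h _; exact: ltW.
apply/eqP => E0.
have fi := bounded_rv_integrable P bf.
have I0 : (\int[P]_(x in setT) `|(EFin \o f) x| = 0)%E.
  under eq_integral => x _ do rewrite /= ger0_norm ?ltW//.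
  have : (\int[P]_x (f x)%:E \is a fin_num)%E by exact: integrable_fin_num.
  by move=> /fineK <-; rewrite -/(Rintegral P setT f) E0.
have mf : measurable_fun [set: T] (EFin \o f) by apply/measurable_EFinP; exact: bf.1.
have [/(_ I0) + _] := ae_eq_integral_abs P measurableT mf.
move=> [N [mN N0 sub]].
have : P setT = 0%E.
  apply/eqP; rewrite eq_le measure_ge0 andbT -N0; apply: le_measure; rewrite ?inE//.
  by move=> x _; apply: sub => /= /(_ I)[] /eqP; rewrite gt_eqF.
by move=> P0; have := probability_setT P; rewrite P0 => /eqP; rewrite eq_sym onee_eq0.
Qed.

End chi2_comparison.

Section gibbs_measure.
Context {R : realType}.
Implicit Types (n : nat) (theta : R).

Definition magnetization n (S : {set 'I_n}) (s : config n) : R :=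
  \sum_(i in S) spin (s i).

Definition field_energy n (h : n.-tuple R) (s : config n) : R :=
  \sum_(i < n) tnth h i * spin (s i).

Lemma spin_norm b : `|spin b : R| = 1.
Proof. by case: b; rewrite /spin ?normrN normr1. Qed.

Lemma magnetization_norm_le n (S : {set 'I_n}) s : `|magnetization S s| <= #|S|%:R.
Proof.
rewrite /magnetization (le_trans (ler_norm_sum _ _ _))//.
by under eq_bigr do rewrite spin_norm; rewrite sumr_const.
Qed.

Lemma gibbs_weightE theta n (S : {set 'I_n}) h s :
  gibbs_weight theta S h s =
  expR (theta / (2 * #|S|%:R) * magnetization S s ^+ 2 + field_energy h s).
Proof.
rewrite /gibbs_weight /magnetization expr2 big_distrlr/=; congr (expR (_ * _ + _)).
Qed.

Lemma partition_gt0 theta n (S : {set 'I_n}) h :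
  0 < \sum_(t : config n) gibbs_weight theta S h t.
Proof.
rewrite (bigD1 [ffun=> true])//= ltr_pwDl ?expR_gt0//.
by apply: sumr_ge0 => i _; exact: expR_ge0.
Qed.

Lemma gibbs_is_pmf theta n (S : {set 'I_n}) h : is_pmf (gibbs theta S h).
Proof.
have Z0 := partition_gt0 theta S h; split=> [c|].
  by rewrite divr_gt0 ?expR_gt0.
by rewrite /gibbs -mulr_suml divff ?gt_eqF.
Qed.

Lemma bounded_rv_gibbs theta n (S : {set 'I_n}) s :
  @bounded_rv _ (n.-tuple (measurableTypeR R)) R (fun h => gibbs theta S h s).
Proof.
have mw t : measurable_fun setT
    (fun h : n.-tuple (measurableTypeR R) => gibbs_weight theta S h t).
  apply: measurableT_comp; first exact: measurable_expR.
  apply: measurable_funD; first exact: measurable_cst.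
  apply: measurable_sum => i; apply: measurable_funM; last exact: measurable_cst.
  exact: measurable_tnth.
split; last first.
  have bnd h : 0 <= gibbs theta S h s <= 1.
    have [g0 g1] := gibbs_is_pmf theta S h; rewrite ltW ?g0//= -g1.
    by rewrite (bigD1 s)//= lerDl sumr_ge0// => i _; exact: ltW.
  by exists 1 => h; have /andP[a b] := bnd h; rewrite ger0_norm.
under eq_fun => h.
  rewrite /gibbs -[X in _ / X]lnK ?posrE ?partition_gt0// -expRN; over.
apply: measurable_funM; first exact: mw.
apply: measurableT_comp; first exact: measurable_expR.
apply: measurable_funN; apply: measurableT_comp; first exact: measurable_ln.
by apply: measurable_sum => i; exact: mw.
Qed.

Variable mu : probability (measurableTypeR R) R.

Lemma pRFCW_is_pmf theta n (S : {set 'I_n}) : is_pmf (pRFCW mu theta S).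
Proof.
split=> [s|].
  apply: expectation_gt0; first exact: bounded_rv_gibbs.
  by move=> h; exact: (gibbs_is_pmf theta S h).1.
rewrite /pRFCW -expectation_sum; last by move=> s; exact: bounded_rv_gibbs.
under eq_Rintegral do rewrite (gibbs_is_pmf theta S _).2.
exact: expectation_cst.
Qed.

(** The exponent of the tilt between the Gibbs measures of two cliques of the same
    size; with [D] the difference of the two magnetizations and [A] their sum it
    is [theta D A / (2 k)], where [D] only sees the swapped sites. *)
Definition energy_gap theta n (S S' : {set 'I_n}) (s : config n) : R :=
  theta / (2 * #|S'|%:R) * (magnetization S s ^+ 2 - magnetization S' s ^+ 2).

Lemma gibbs_tilt theta n (S S' : {set 'I_n}) h : #|S| = #|S'| ->
  gibbs theta S h = (fun s => gibbs theta S' h s * expR (energy_gap theta S S' s) /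
    (\sum_t gibbs theta S' h t * expR (energy_gap theta S S' t))).
Proof.
move=> SS'; apply/funext => s.
have W t : gibbs_weight theta S h t =
    gibbs_weight theta S' h t * expR (energy_gap theta S S' t).
  by rewrite !gibbs_weightE -expRD SS' /energy_gap; congr expR; ring.
have Z0 := partition_gt0 theta S' h; have Z1 := partition_gt0 theta S h.
have -> : \sum_t gibbs theta S' h t * expR (energy_gap theta S S' t) =
   (\sum_t gibbs_weight theta S h t) / (\sum_t gibbs_weight theta S' h t).
  by rewrite mulr_suml; apply: eq_bigr => t _; rewrite /gibbs W mulrAC.
rewrite /gibbs [gibbs_weight theta S h s]W; field.
by rewrite !gt_eqF.
Qed.

Lemma magnetization_swap n (S S' : {set 'I_n}) s : #|S| = #|S'| ->
  (#|S :\: S'| <= 2)%N -> `|magnetization S s - magnetization S' s| <= 4.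
Proof.
move=> SS' d2.
have d2' : (#|S' :\: S| <= 2)%N.
  by rewrite cardsD finset.setIC -SS' -cardsD.
rewrite /magnetization (big_setID S')/= [X in _ - X](big_setID S)/= finset.setIC.
rewrite opprD addrACA subrr add0r (le_trans (ler_normB _ _))//.
have A (B : {set 'I_n}) : (#|B| <= 2)%N -> `|\sum_(i in B) spin (s i) : R| <= 2.
  by move=> B2; apply: le_trans (magnetization_norm_le B s) _; rewrite ler_nat.
by rewrite (_ : 4 = 2 + 2 :> R) ?lerD ?A//; ring.
Qed.

Lemma energy_gap_sqr_le theta n (S S' : {set 'I_n}) s : 0 < theta ->
  #|S| = #|S'| -> (0 < #|S'|)%N -> (#|S :\: S'| <= 2)%N ->
  `|energy_gap theta S S' s| <= 4 * theta /\
  energy_gap theta S S' s ^+ 2 <=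
    32 * theta ^+ 2 * ((magnetization S' s / #|S'|%:R) ^+ 2 + 4 / #|S'|%:R ^+ 2).
Proof.
move=> th0 SS' N0 d2; have N0' : 0 < #|S'|%:R :> R by rewrite ltr0n.
have := magnetization_swap s SS' d2.
have := magnetization_norm_le S' s; have := magnetization_norm_le S s; rewrite SS'.
rewrite /energy_gap; set M := magnetization S s; set M' := magnetization S' s.
set N := #|S'|%:R in N0' * => MN M'N dl.
have -> : theta / (2 * N) * (M ^+ 2 - M' ^+ 2) =
    theta * ((M - M') / 2) * ((M + M') / N) by field; rewrite gt_eqF.
have q2 : `|(M + M') / N| <= 2.
  rewrite normrM [`|N^-1|]ger0_norm ?invr_ge0 ?(ltW N0')// ler_pdivrMr//.
  by rewrite (le_trans (ler_normD _ _))//; lra.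
have d1 : `|(M - M') / 2| <= 2 by rewrite normrM [`|2^-1|]ger0_norm ?invr_ge0//; lra.
split.
  rewrite !normrM (ger0_norm (ltW th0)) mulrC mulrCA.
  have -> : 4 * theta = theta * (2 * 2) by ring.
  by rewrite ler_pM2l// mulrC ler_pM// -normrM.
have dd : ((M - M') / 2) ^+ 2 <= 4.
  rewrite -[leLHS]real_normK ?num_real// (_ : 4 = 2 ^+ 2 :> R); last by ring.
  by rewrite lerXn2r ?nnegrE.
have mm : (M + M') ^+ 2 <= 8 * (M' ^+ 2 + 4).
  have dsq : (M - M') ^+ 2 <= 16.
    by rewrite -[leLHS]real_normK ?num_real// (_ : 16 = 4 ^+ 2 :> R) ?lerXn2r ?nnegrE//; ring.
  by have := sqr_ge0 (2 * M' - (M - M')); lra.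
have N2 : 0 < N ^+ 2 by rewrite exprn_gt0.
have bb : ((M + M') / N) ^+ 2 <= 8 * ((M' / N) ^+ 2 + 4 / N ^+ 2).
  rewrite !expr_div_n -mulrDl mulrA ler_pM2r ?invr_gt0//.
rewrite exprMn [(theta * _) ^+ 2]exprMn.
have := ler_pM (sqr_ge0 _) (sqr_ge0 _) dd bb.
by move=> /(ler_wpM2l (sqr_ge0 theta)); lra.
Qed.

(** The comparison of the Gibbs measures at a fixed field passes to the mixtures
    over the field by joint convexity. *)
Lemma kl_swap theta n (S S' : {set 'I_n}) (V : n.-tuple (measurableTypeR R) -> R) :
  0 < theta -> #|S| = #|S'| -> (0 < #|S'|)%N -> (#|S :\: S'| <= 2)%N ->
  bounded_rv V ->
  (forall h, \sum_s gibbs theta S' h s * (magnetization S' s / #|S'|%:R) ^+ 2 <= V h) ->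
  kl (pRFCW mu theta S) (pRFCW mu theta S') <=
    expR (16 * theta) * (32 * theta ^+ 2) *
      ((\int[iid_law mu n]_h V h) + 4 / #|S'|%:R ^+ 2).
Proof.
move=> th0 SS' N0 d2 bV HV.
apply: le_trans (kl_le_chi2 (pRFCW_is_pmf _ _) (pRFCW_is_pmf _ _)) _.
have bV4 : @bounded_rv _ (n.-tuple (measurableTypeR R)) R (fun h => V h + 4 / #|S'|%:R ^+ 2).
  by apply: bounded_rvD => //; exact: bounded_rv_cst.
have <- : \int[iid_law mu n]_h (V h + 4 / #|S'|%:R ^+ 2) =
    (\int[iid_law mu n]_h V h) + 4 / #|S'|%:R ^+ 2.
  by rewrite expectationD ?expectation_cst//; exact: bounded_rv_cst.
rewrite -expectationZ//.
apply: (@chi2_expectation _ _ _ (iid_law mu n) (config n)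
  (fun s h => gibbs theta S h s) (fun s h => gibbs theta S' h s)
  (fun h => expR (16 * theta) * (32 * theta ^+ 2) * (V h + 4 / #|S'|%:R ^+ 2))).
- by move=> s; exact: bounded_rv_gibbs.
- by move=> s; exact: bounded_rv_gibbs.
- by apply: bounded_rvM => //; exact: bounded_rv_cst.
- by move=> s h; exact: (gibbs_is_pmf theta S' h).1.
- by move=> s; exact: (pRFCW_is_pmf theta S').1.
move=> h; rewrite -[X in chi2 X _]/(gibbs theta S h) (gibbs_tilt theta h SS').
apply: le_trans (chi2_tilt (gibbs_is_pmf theta S' h) _) _.
  by move=> s; exact: (energy_gap_sqr_le s th0 SS' N0 d2).1.
have -> : 4 * (4 * theta) = 16 * theta by ring.
rewrite -mulrA ler_pM2l ?expR_gt0//.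
have [g0 g1] := gibbs_is_pmf theta S' h.
apply: (@le_trans _ _ (\sum_s gibbs theta S' h s * (32 * theta ^+ 2 *
   ((magnetization S' s / #|S'|%:R) ^+ 2 + 4 / #|S'|%:R ^+ 2)))).
  apply: ler_sum => s _; rewrite ler_pM2l//.
  exact: (energy_gap_sqr_le s th0 SS' N0 d2).2.
under eq_bigr do rewrite mulrCA; rewrite -mulr_sumr.
rewrite ler_pM2l ?mulr_gt0 ?exprn_gt0//.
under eq_bigr do rewrite mulrDr; rewrite big_split/= lerD//.
by rewrite -mulr_suml g1 mul1r.
Qed.

End gibbs_measure.

(** * Decoupling the quadratic energy *)

Section susceptibility.
Context {R : realType}.
Implicit Types (n : nat) (theta : R).

Lemma sum_config_expR n (a : 'I_n -> R) :
  \sum_(s : config n) expR (\sum_i a i * spin (s i)) = \prod_i (2 * cosh (a i)).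
Proof.
transitivity (\prod_(i < n) \sum_(b : bool) expR (a i * spin b)).
  rewrite (bigA_distr_bigA (fun i (b : bool) => expR (a i * spin b))).
  by apply: eq_bigr => s _; rewrite expR_sum.
apply: eq_bigr => i _; rewrite big_bool /spin/= mulr1 mulrN1 /cosh; by field.
Qed.

(** The spins are independent once the energy is linear. *)
Lemma sum_config_tilt n (S : {set 'I_n}) (h : n.-tuple R) (t : R) :
  \sum_s expR (field_energy h s + t * magnetization S s) =
  (\sum_s expR (field_energy h s)) *
    expR (\sum_(i in S) (lncosh (t + tnth h i) - lncosh (tnth h i))).
Proof.
pose a i := tnth h i + (if i \in S then t else 0).
transitivity (\sum_(s : config n) expR (\sum_i a i * spin (s i))).
  apply: eq_bigr => s _; congr expR.
  rewrite /field_energy /magnetization mulr_sumr (big_mkcond (mem S))/= -big_split/=.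
  by apply: eq_bigr => i _; rewrite /a; case: ifP => _; ring.
rewrite sum_config_expR [X in _ = X * _](sum_config_expR (tnth h)) expR_sum.
rewrite [X in _ = _ * X]big_mkcond -big_split/=.
apply: eq_bigr => i _; rewrite /a; case: ifP => _; last by rewrite addr0 mulr1.
rewrite expRB /lncosh !lnK ?posrE ?cosh_gt0// [t + _]addrC.
by field; rewrite gt_eqF ?cosh_gt0.
Qed.

Lemma nearest_signed_nat (u : R) (J : nat) : `|u| < J%:R ->
  exists b, exists2 j : nat, (j <= J)%N & `|u - spin b * j%:R| <= 2^-1.
Proof.
move=> uJ; have u0 : 0 <= `|u| + 2^-1 by rewrite addr_ge0.
have := truncn_itv u0; set j := Num.truncn _ => /andP[j1 j2].
have jJ : (j <= J)%N.
  by rewrite -ltnS -(ltr_nat R) (le_lt_trans j1)// -[J.+1%:R]natr1; lra.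
exists (0 <= u), j => //; rewrite -(natr1 j) in j2.
move: j1 j2; rewrite /spin; have [u1|u1] := leP 0 u.
  by rewrite ger0_norm// => a b /=; rewrite ler_norml; lra.
by rewrite ltr0_norm// => a b /=; rewrite ler_norml; lra.
Qed.

Lemma sum_inv_sqr_le (J : nat) : \sum_(j < J.+1) (j%:R ^+ 2)^-1 <= 2 :> R.
Proof.
suff H k : \sum_(j < k.+2) (j%:R ^+ 2)^-1 <= 2 - k.+1%:R^-1 :> R.
  case: J => [|J]; first by rewrite big_ord1 expr0n invr0.
  by apply: le_trans (H J) _; rewrite gerBl invr_ge0.
elim: k => [|k IH].
  by rewrite !big_ord_recl big_ord0 /= expr0n invr0 expr1n invr1; lra.
rewrite big_ord_recr/=; apply: le_trans (lerD IH (lexx _)) _.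
rewrite -addrA lerD2l -subr_ge0 -(natr1 k.+1); set x : R := k.+1%:R.
have x0 : 0 < x by rewrite ltr0n.
have -> : - (x + 1)^-1 - (- x^-1 + ((x + 1) ^+ 2)^-1) = (x * (x + 1) ^+ 2)^-1.
  by field; rewrite !gt_eqF//; lra.
by rewrite invr_ge0 mulr_ge0 ?sqr_ge0// ltW.
Qed.

(** Away from the origin at scale [eps], exponential decay at rate [N y^tau]
    with [tau = k + 1] beats the factor [y = jj / N]: for [jj = j^2] the bound
    [exp (- t) <= 4 / t^2] already yields terms of order [eps / j^2], which are
    summable over the grid. *)
Lemma tail_term_le (t N c eps y jj : R) (k : nat) :
  0 < N -> 0 < c -> 0 < eps -> N * eps ^+ (2 * k).+1 = 1 -> eps <= y ->
  y = jj / N -> 0 < jj -> t <= - (c / 2 * N * y ^+ k.+1) ->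
  y * expR t <= 16 / c ^+ 2 * eps * jj^-1.
Proof.
move=> N0 c0 e0 Ne ey yE jj0 tE.
have y0 : 0 < y by exact: lt_le_trans ey.
set T := c / 2 * N * y ^+ k.+1 in tE.
have T0 : 0 < T by rewrite !mulr_gt0 ?exprn_gt0 ?divr_gt0.
have : expR t <= 4 / T ^+ 2.
  by apply: le_trans (expRN_le_inv_sqr T0); rewrite ler_expR.
move=> /(ler_wpM2l (ltW y0)) /le_trans; apply.
have -> : y * (4 / T ^+ 2) = 16 / c ^+ 2 / (N ^+ 2 * y) / (y ^+ 2) ^+ k.
  have -> : T = c / 2 * N * (y * y ^+ k) by rewrite /T exprS.
  set z := y ^+ k; have -> : (y ^+ 2) ^+ k = z ^+ 2 by rewrite exprAC.
  have z0 : 0 < z by exact: exprn_gt0.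
  by field; rewrite !gt_eqF.
have E0 : 0 < (eps ^+ 2) ^+ k by rewrite !exprn_gt0.
have epsE : eps = (N * (eps ^+ 2) ^+ k)^-1.
  have NE : N * (eps ^+ 2) ^+ k != 0 by rewrite gt_eqF// mulr_gt0.
  by apply: (mulfI NE); rewrite divff// -Ne [eps ^+ (2 * k).+1]exprSr exprM mulrA.
have -> : 16 / c ^+ 2 * eps * jj^-1 = 16 / c ^+ 2 / (N ^+ 2 * y) / (eps ^+ 2) ^+ k.
  rewrite {1}epsE yE; set E := (eps ^+ 2) ^+ k in E0 *.
  by field; rewrite !gt_eqF.
rewrite ler_wpM2l//.
  by rewrite !divr_ge0 ?mulr_ge0 ?sqr_ge0// ltW.
rewrite lef_pV2 ?posrE ?exprn_gt0//.
by rewrite lerXn2r ?nnegrE ?sqr_ge0// lerXn2r ?nnegrE// ltW.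
Qed.

End susceptibility.

(** * Uniform control of the field fluctuations *)

Section susceptibility_bound.
Context {R : realType}.
Variables (mu : probability (measurableTypeR R) R) (theta : R).
Hypothesis theta_gt0 : 0 < theta.

Lemma sum_norm_sqr_le (J : nat) (e : 'I_J -> R) :
  (\sum_l `|e l|) ^+ 2 <= J%:R * \sum_l e l ^+ 2.
Proof.
rewrite expr2 big_distrlr/=.
have -> : J%:R * (\sum_l e l ^+ 2) = \sum_(i < J) \sum_(j < J) (e i ^+ 2 + e j ^+ 2) / 2.
  set Q := \sum_l e l ^+ 2.
  rewrite [RHS](eq_bigr (fun i => J%:R / 2 * e i ^+ 2 + Q / 2)); last first.
    move=> i _; rewrite -mulr_suml big_split/= sumr_const card_ord -mulr_natl -/Q.
    by field.
  by rewrite big_split/= -mulr_sumr -/Q sumr_const card_ord -mulr_natl; field.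
apply: ler_sum => i _; apply: ler_sum => j _.
have := sqr_ge0 (`|e i| - `|e j|).
have := real_normK (num_real (e i)); have := real_normK (num_real (e j)).
move=> <- <-; lra.
Qed.

(** A discrete Sobolev inequality: a sequence vanishing at [0] is controlled at
    all sites at once by its first step and its second differences.  Applied to
    the field fluctuations it replaces a supremum over the grid by a sum of
    squares. *)
Lemma discrete_sobolev (a : nat -> R) (J j : nat) : a 0%N = 0 -> (j <= J)%N ->
  a j ^+ 2 <= j%:R ^+ 2 *
    (2 * a 1%N ^+ 2 + 2 * J%:R * \sum_(l < J) (a l.+2 - 2 * a l.+1 + a l) ^+ 2).
Proof.
move=> a0; pose e l := a l.+2 - 2 * a l.+1 + a l.
pose D := `|a 1%N| + \sum_(l < J) `|e l|.
have D0 : 0 <= D by rewrite addr_ge0// sumr_ge0.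
have step l : (l <= J)%N -> `|a l.+1 - a l| <= `|a 1%N| + \sum_(i < l) `|e i|.
  elim: l => [|l IH] lJ; first by rewrite a0 subr0 big_ord0 addr0.
  have -> : a l.+2 - a l.+1 = (a l.+1 - a l) + e l by rewrite /e; ring.
  rewrite big_ord_recr/= [leRHS]addrA (le_trans (ler_normD _ _))// lerD2r IH//.
  exact: ltnW.
have stepD l : (l <= J)%N -> `|a l.+1 - a l| <= D.
  move=> lJ; apply: le_trans (step l lJ) _; rewrite /D lerD2l.
  rewrite -!(big_mkord xpredT (fun i => `|e i|)) [leRHS](big_cat_nat (n := l))//=.
  by rewrite lerDl; apply: sumr_ge0.
have aD : (j <= J)%N -> `|a j| <= j%:R * D.
  elim: j => [|j IH] jJ; first by rewrite a0 normr0 mul0r.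
  have -> : a j.+1 = a j + (a j.+1 - a j) by ring.
  rewrite -natr1 mulrDl mul1r (le_trans (ler_normD _ _))// lerD ?IH ?stepD//; exact: ltnW.
move=> jJ; rewrite -[leLHS]real_normK ?num_real//.
apply: (@le_trans _ _ ((j%:R * D) ^+ 2)).
  by rewrite lerXn2r ?nnegrE ?aD// mulr_ge0.
rewrite exprMn ler_wpM2l ?sqr_ge0//.
have := @sum_norm_sqr_le J e; set q := \sum_(l < J) `|e l|; set Q := \sum_(l < J) _.
rewrite /D -/q -[a 1%N ^+ 2]real_normK ?num_real// => qQ.
have := sqr_ge0 (`|a 1%N| - q); lra.
Qed.

Lemma sobolev_bound_ge0 (x : R) (J : nat) (e : 'I_J -> R) :
  0 <= 2 * x ^+ 2 + 2 * J%:R * \sum_l e l ^+ 2.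
Proof.
apply: addr_ge0; first by apply: mulr_ge0 => //; exact: sqr_ge0.
by apply: mulr_ge0; [exact: mulr_ge0|apply: sumr_ge0 => l _; exact: sqr_ge0].
Qed.

Definition fluctuation n (S : {set 'I_n}) (x : R) (h : n.-tuple R) : R :=
  \sum_(i in S) (lncosh_shift theta x (tnth h i) - Lambda mu theta x).

(** The step [1 / sqrt N] matches the width of the Gaussian weight
    [exp (- N x^2 / 2)]. *)
Definition grid (N : R) (b : bool) (j : nat) : R := spin b * j%:R / Num.sqrt N.

(** The random constant of the field: it bounds the squared fluctuation at the
    grid point [j], relative to [j^2], for all [j <= J] at once. *)
Definition roughness n (S : {set 'I_n}) (J : nat) (h : n.-tuple R) : R :=
  let a b j := fluctuation S (grid #|S|%:R b j) h in
  \sum_(b : bool) (2 * a b 1%N ^+ 2 +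
    2 * J%:R * \sum_(l < J) (a b l.+2 - 2 * a b l.+1 + a b l) ^+ 2).

Lemma roughness_ge0 n (S : {set 'I_n}) J h : 0 <= roughness S J h.
Proof.
by apply: sumr_ge0 => b _; exact: sobolev_bound_ge0.
Qed.

Lemma fluctuation_le_roughness n (S : {set 'I_n}) J h b j : (j <= J)%N ->
  fluctuation S (grid #|S|%:R b j) h ^+ 2 <= j%:R ^+ 2 * roughness S J h.
Proof.
move=> jJ; pose a j := fluctuation S (grid #|S|%:R b j) h.
have a0 : a 0%N = 0.
  rewrite /a /grid mulr0 mul0r /fluctuation big1// => i _.
  by rewrite lncosh_shift0 Lambda0 subrr.
apply: le_trans (discrete_sobolev a0 jJ) _; rewrite ler_wpM2l ?sqr_ge0//.
rewrite /roughness (bigD1 b)//= lerDl; apply: sumr_ge0 => c _.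
exact: sobolev_bound_ge0.
Qed.

Definition susceptibility_const (c : R) : R :=
  3 / theta * (1 + 4 / c ^+ 2) + 3 / theta * expR (8^-1) * (64 / c ^+ 2).

Lemma susceptibility_const_gt0 c : 0 < c -> 0 < susceptibility_const c.
Proof.
move=> c0; have th : 0 < 3 / theta by rewrite divr_gt0.
have c4 : 0 < 4 / c ^+ 2 by rewrite divr_gt0// exprn_gt0.
have c64 : 0 < 64 / c ^+ 2 by rewrite divr_gt0// exprn_gt0.
apply: addr_gt0; apply: mulr_gt0 => //; first by lra.
by apply: mulr_gt0 => //; exact: expR_gt0.
Qed.

End susceptibility_bound.

(** * The squared magnetization for a fixed field *)

Section susceptibility_main.
Context {R : realType}.
Variables (mu : probability (measurableTypeR R) R) (theta : R).
Hypothesis theta_gt0 : 0 < theta.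
Variables (n : nat) (S : {set 'I_n}) (h : n.-tuple R).
Let N : R := #|S|%:R.
Hypothesis S_gt0 : (0 < #|S|)%N.

Let N_gt0 : 0 < N. Proof. by rewrite ltr0n. Qed.
Let sN_gt0 : 0 < Num.sqrt N. Proof. by rewrite sqrtr_gt0. Qed.
Let sNK : Num.sqrt N ^+ 2 = N. Proof. by rewrite sqr_sqrtr// ltW. Qed.
Let st_gt0 : 0 < Num.sqrt theta. Proof. by rewrite sqrtr_gt0. Qed.
Let stK : Num.sqrt theta ^+ 2 = theta. Proof. by rewrite sqr_sqrtr// ltW. Qed.

Definition tilted_weight (b : bool) (j : nat) (s : config n) : R :=
  expR (field_energy h s + Num.sqrt theta * grid N b j * magnetization S s -
    j%:R ^+ 2 / 2).

Lemma spin_sqr b : spin b ^+ 2 = 1 :> R.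
Proof. by case: b; rewrite /spin/= ?sqrrN expr1n. Qed.

Lemma grid_sqr b j : grid N b j ^+ 2 = j%:R ^+ 2 / N.
Proof. by rewrite /grid expr_div_n exprMn spin_sqr mul1r sNK. Qed.

(** A discrete Hubbard-Stratonovich bound: [e^(u^2/2)] is at most [e^(1/8)]
    times the single term [e^(j u - j^2/2)] with [j] the integer nearest to [u].
    The grid step [1/sqrt N] is the scale of the Gaussian in the usual
    transform, so nothing is lost by summing over the grid. *)
Lemma weight_le_tilted (J : nat) (rho2 : R) s :
  Num.sqrt theta * Num.sqrt N < J%:R -> N^-1 <= rho2 ->
  gibbs_weight theta S h s * (magnetization S s / N) ^+ 2 <=
  3 / theta * rho2 * gibbs_weight theta S h s +
  3 / theta * expR 8^-1 * \sum_(b : bool) \sum_(j < J.+1)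
    (if rho2 < j%:R ^+ 2 / N then j%:R ^+ 2 / N * tilted_weight b j s else 0).
Proof.
move=> sJ rhoN; set M := magnetization S s.
have w0 : 0 < gibbs_weight theta S h s by exact: expR_gt0.
pose u := Num.sqrt theta * M / Num.sqrt N.
have sNn0 : Num.sqrt N != 0 by rewrite gt_eqF.
have uE : (M / N) ^+ 2 = u ^+ 2 / (theta * N).
  rewrite /u !expr_div_n exprMn stK sNK; field.
  by rewrite !gt_eqF.
have uJ : `|u| < J%:R.
  apply: le_lt_trans sJ; rewrite /u normrM normrM (ger0_norm (ltW st_gt0)) -mulrA.
  rewrite ler_pM2l// [`|(Num.sqrt N)^-1|]ger0_norm ?invr_ge0 ?(ltW sN_gt0)// ler_pdivrMr// -expr2 sNK.
  exact: magnetization_norm_le.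
have tN : 0 < theta * N by exact: mulr_gt0.
have t3 : 0 < 3 / theta by exact: divr_gt0.
pose F b j := if rho2 < j%:R ^+ 2 / N then j%:R ^+ 2 / N * tilted_weight b j s else 0.
have F0 b j : 0 <= F b j.
  rewrite /F; case: ifP => // _; apply: mulr_ge0; last exact: expR_ge0.
  by rewrite divr_ge0 ?sqr_ge0 ?ltW.
have [b [j jJ near]] := nearest_signed_nat uJ.
have near2 : (u - spin b * j%:R) ^+ 2 <= 4^-1.
  rewrite -[leLHS]real_normK ?num_real// (_ : 4^-1 = 2^-1 ^+ 2); last by field.
  by rewrite lerXn2r ?nnegrE.
have sj2 : (spin b * j%:R) ^+ 2 = j%:R ^+ 2 :> R by rewrite exprMn spin_sqr mul1r.
have u2 : u ^+ 2 <= 2^-1 + 2 * j%:R ^+ 2.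
  by have := sqr_ge0 (u - 2 * (spin b * j%:R)); lra.
have Fle : F b j <= \sum_(b : bool) \sum_(j < J.+1) F b j.
  rewrite (bigD1 b)//= (bigD1 (inord j))//= inordK//.
  by rewrite -addrA lerDl addr_ge0 ?sumr_ge0// => ? _; rewrite sumr_ge0.
rewrite -/(F _ _); have [far|close] := ltP rho2 (j%:R ^+ 2 / N); last first.
  have q : (M / N) ^+ 2 <= 3 / theta * rho2.
    rewrite uE ler_pdivrMr//.
    have -> : 3 / theta * rho2 * (theta * N) = 3 * (rho2 * N).
      by field; rewrite gt_eqF.
    have := ler_wpM2r (ltW N_gt0) rhoN; have := ler_wpM2r (ltW N_gt0) close.
    by rewrite mulVf ?gt_eqF// divfK ?gt_eqF//; lra.
  apply: ler_wpDr; last by rewrite mulrC ler_pM2r.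
  apply: mulr_ge0; first by apply: mulr_ge0; [exact: ltW|exact: expR_ge0].
  by apply: sumr_ge0 => b' _; apply: sumr_ge0 => j' _; exact: F0.
apply: ler_wpDl.
  apply: mulr_ge0; last exact: ltW.
  by apply: mulr_ge0; [exact: ltW|apply: le_trans rhoN; rewrite invr_ge0 ltW].
apply: (@le_trans _ _ (3 / theta * expR 8^-1 * F b j)); last first.
  by apply: ler_wpM2l => //; apply: mulr_ge0; [exact: ltW|exact: expR_ge0].
have j1 : 1 <= j%:R ^+ 2 :> R.
  have : (0 < j)%N.
    rewrite lt0n; apply/eqP => j0; move: far; rewrite j0 expr0n/= mul0r.
    by rewrite ltNge (le_trans _ rhoN)// invr_ge0 ltW.
  by move=> j0; rewrite -natrX ler1n expn_gt0 j0.
have q : (M / N) ^+ 2 <= 3 / theta * (j%:R ^+ 2 / N).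
  rewrite uE ler_pdivrMr//.
  have -> : 3 / theta * (j%:R ^+ 2 / N) * (theta * N) = 3 * j%:R ^+ 2.
    by field; rewrite !gt_eqF.
  lra.
have wt : gibbs_weight theta S h s <= expR 8^-1 * tilted_weight b j s.
  rewrite gibbs_weightE /tilted_weight -expRD ler_expR -/N -/M.
  have -> : theta / (2 * N) * M ^+ 2 = u ^+ 2 / 2.
    rewrite /u !expr_div_n exprMn stK sNK; field; by rewrite !gt_eqF.
  have -> : Num.sqrt theta * grid N b j * M = u * (spin b * j%:R).
    by rewrite /grid /u; field.
  by rewrite -sj2; lra.
rewrite /F far mulrC.
have -> : 3 / theta * expR 8^-1 * (j%:R ^+ 2 / N * tilted_weight b j s) =
  3 / theta * (j%:R ^+ 2 / N) * (expR 8^-1 * tilted_weight b j s) by ring.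
by apply: ler_pM; rewrite ?sqr_ge0 ?(ltW w0).
Qed.

Lemma sum_tilted_weight b j :
  \sum_s tilted_weight b j s = (\sum_s expR (field_energy h s)) *
    expR (- (j%:R ^+ 2 / 2) + \sum_(i in S) lncosh_shift theta (grid N b j) (tnth h i)).
Proof.
rewrite expRD mulrCA -sum_config_tilt mulr_sumr; apply: eq_bigr => s _.
by rewrite /tilted_weight -expRD addrC.
Qed.

Lemma field_partition_le :
  \sum_s expR (field_energy h s) <= \sum_s gibbs_weight theta S h s.
Proof.
apply: ler_sum => s _; rewrite gibbs_weightE ler_expR lerDr.
by rewrite mulr_ge0 ?sqr_ge0// divr_ge0 ?mulr_ge0// ltW.
Qed.

(** Beyond the scale [eps (1 + W)], [W] being the roughness, the fluctuation of the
    field takes at most half of the coercive term: its square is at most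
    [N y W] with [y = x^2], and [W <= (c^2/4) N y^(2 k + 1)] follows from
    [y > (1 + 4 / c^2) eps (1 + W)] by raising to the power [2 k + 1]. *)
Lemma exponent_le (c eps : R) (k J j : nat) b :
  0 < c -> 0 < eps -> N * eps ^+ (2 * k).+1 = 1 -> (j <= J)%N ->
  (forall x, `|x| * Num.sqrt N <= J%:R ->
    c * `|x| ^+ (2 * k.+1) <= x ^+ 2 / 2 - Lambda mu theta x) ->
  (1 + 4 / c ^+ 2) * (eps * (1 + roughness mu theta S J h)) < j%:R ^+ 2 / N ->
  - (j%:R ^+ 2 / 2) + \sum_(i in S) lncosh_shift theta (grid N b j) (tnth h i)
    <= - (c / 2 * N * (j%:R ^+ 2 / N) ^+ k.+1).
Proof.
move=> c0 e0 Ne jJ coer; set W := roughness _ _ _ _ _.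
have W0 : 0 <= W by exact: roughness_ge0.
set y := j%:R ^+ 2 / N; set K := 1 + 4 / c ^+ 2 => far.
set x := grid N b j; have x2 : x ^+ 2 = y by exact: grid_sqr.
have c2 : 0 < c ^+ 2 by exact: exprn_gt0.
have K1 : 1 <= K by rewrite lerDl divr_ge0// ltW.
have rho0 : 0 < K * (eps * (1 + W)).
  by rewrite !mulr_gt0//; lra.
have y0 : 0 < y by exact: lt_trans far.
have xJ : `|x| * Num.sqrt N <= J%:R.
  rewrite /x /grid !normrM spin_norm mul1r [`|(Num.sqrt N)^-1|]ger0_norm.
    by rewrite mulfVK ?gt_eqF// normr_nat ler_nat.
  by rewrite invr_ge0 ltW.
have := coer _ xJ; have -> : `|x| ^+ (2 * k.+1) = y ^+ k.+1.
  by rewrite exprM real_normK ?num_real// x2.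
set z := y ^+ k.+1; have z0 : 0 < z by exact: exprn_gt0.
rewrite x2 => cz.
have -> : \sum_(i in S) lncosh_shift theta x (tnth h i) =
    N * Lambda mu theta x + fluctuation mu theta S x h.
  rewrite /fluctuation [in RHS]sumrB.
  rewrite [X in _ + (_ - X)]sumr_const -mulr_natl -/N; ring.
have -> : j%:R ^+ 2 / 2 = N * (y / 2).
  by rewrite /y; field; rewrite gt_eqF.
suff D : fluctuation mu theta S x h <= c / 2 * N * z.
  have : N * (c * z) <= N * (y / 2 - Lambda mu theta x) by rewrite ler_pM2l.
  lra.
have B0 : 0 < c / 2 * N * z by rewrite !mulr_gt0// divr_gt0.
have pw : 1 + W <= c ^+ 2 / 4 * (N * y ^+ (2 * k).+1).
  have : (K * (1 + W) * eps) ^+ (2 * k).+1 <= y ^+ (2 * k).+1.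
    rewrite lerXn2r ?nnegrE ?(ltW y0)//; first by rewrite -mulrA [_ * eps]mulrC ltW.
    by rewrite -mulrA [_ * eps]mulrC ltW.
  move=> /(ler_wpM2l (ltW N_gt0)); rewrite exprMn [_ ^+ _ * eps ^+ _]mulrC [X in X <= _ -> _]mulrA Ne mul1r.
  have : K * (1 + W) <= (K * (1 + W)) ^+ (2 * k).+1.
    by rewrite ler_eXnr// (le_trans K1)// ler_peMr; lra.
  move=> /le_trans /[apply]; rewrite -(ler_pM2l (x := c ^+ 2 / 4)) ?divr_gt0//.
  apply: le_trans; rewrite mulrA ler_peMl//; first by lra.
  have -> : c ^+ 2 / 4 * K = c ^+ 2 / 4 + 1 by rewrite /K; field; rewrite gt_eqF.
  by rewrite lerDr divr_ge0// ltW.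
have fl := fluctuation_le_roughness mu theta S h b jJ; rewrite -/N -/x -/W in fl.
have : fluctuation mu theta S x h ^+ 2 <= (c / 2 * N * z) ^+ 2.
  apply: le_trans fl _.
  have -> : (c / 2 * N * z) ^+ 2 = N * y * (c ^+ 2 / 4 * (N * y ^+ (2 * k).+1)).
    have -> : z = y * y ^+ k by rewrite /z exprS.
    have -> : y ^+ (2 * k).+1 = y * (y ^+ k) ^+ 2 by rewrite exprS mulnC exprM.
    by set v := y ^+ k; field.
  have -> : N * y = j%:R ^+ 2 by rewrite /y; field; rewrite gt_eqF.
  by rewrite ler_wpM2l ?sqr_ge0// (le_trans _ pw)// lerDr.
move=> h2; apply: le_trans (ler_norm _) _.
by rewrite -ler_sqr ?nnegrE ?(ltW B0)// real_normK ?num_real.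
Qed.

End susceptibility_main.

Section susceptibility_assembled.
Context {R : realType}.
Variables (mu : probability (measurableTypeR R) R) (theta : R).
Hypothesis theta_gt0 : 0 < theta.

(** Grid points below the scale [rho2] contribute at most [rho2] to the squared
    magnetization; the others contribute at most [eps] in total, relative to the
    weight of the free spins. *)
Lemma susceptibility_le n (S : {set 'I_n}) (h : n.-tuple R) (c eps : R) (k J : nat) :
  (0 < #|S|)%N -> 0 < c -> 0 < eps -> #|S|%:R * eps ^+ (2 * k).+1 = 1 ->
  Num.sqrt theta * Num.sqrt #|S|%:R < J%:R ->
  (forall x, `|x| * Num.sqrt #|S|%:R <= J%:R ->
    c * `|x| ^+ (2 * k.+1) <= x ^+ 2 / 2 - Lambda mu theta x) ->
  \sum_s gibbs theta S h s * (magnetization S s / #|S|%:R) ^+ 2 <=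
    susceptibility_const theta c * (eps * (1 + roughness mu theta S J h)).
Proof.
move=> S0 c0 e0 Ne sJ coer; set N : R := #|S|%:R in Ne sJ coer *.
have N0 : 0 < N by rewrite ltr0n.
have N1 : 1 <= N by rewrite ler1n.
set W := roughness _ _ _ _ _; have W0 : 0 <= W by exact: roughness_ge0.
pose K := 1 + 4 / c ^+ 2; pose rho2 := K * (eps * (1 + W)).
have c2 : 0 < c ^+ 2 by exact: exprn_gt0.
have K1 : 1 <= K by rewrite lerDl divr_ge0// ltW.
have e1 : eps <= 1.
  rewrite -(@expr_le1 _ (2 * k).+1) ?(ltW e0)// -Ne.
  by rewrite ler_peMl// exprn_ge0// ltW.
have epsW : eps <= eps * (1 + W) by rewrite ler_peMr ?(ltW e0)// lerDl.
have eps_rho : eps <= rho2.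
  apply: le_trans epsW _; rewrite /rho2 ler_peMl// mulr_ge0 ?(ltW e0)//; lra.
have rhoN : N^-1 <= rho2.
  apply: le_trans eps_rho.
  have -> : N^-1 = eps ^+ (2 * k).+1 by rewrite -[LHS]mulr1 -Ne mulKf// gt_eqF.
  by rewrite exprSr ler_piMl ?(ltW e0) ?exprn_ile1 ?(ltW e0).
set Z := \sum_s gibbs_weight theta S h s.
have Z0 : 0 < Z by exact: partition_gt0.
have -> : \sum_s gibbs theta S h s * (magnetization S s / N) ^+ 2 =
    (\sum_s gibbs_weight theta S h s * (magnetization S s / N) ^+ 2) / Z.
  by rewrite mulr_suml; apply: eq_bigr => s _; rewrite /gibbs -/Z mulrAC.
have pt s := weight_le_tilted theta_gt0 h S0 s sJ rhoN.
rewrite ler_pdivrMr//; apply: le_trans (ler_sum _ (fun s _ => pt s)) _.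
rewrite big_split/= -mulr_sumr -/Z -mulr_sumr.
set tail := (X in _ + _ * X <= _).
have tailE : tail <= 64 / c ^+ 2 * eps * Z.
  rewrite /tail exchange_big/=.
  have -> : 64 / c ^+ 2 * eps * Z = \sum_(b : bool) (32 / c ^+ 2 * eps * Z).
    by rewrite big_bool/=; field; rewrite gt_eqF.
  apply: ler_sum => b _; rewrite exchange_big/=.
  have -> : 32 / c ^+ 2 * eps * Z = 16 / c ^+ 2 * eps * Z * 2.
    by field; rewrite gt_eqF.
  have C0 : 0 <= 16 / c ^+ 2 * eps * Z.
    by apply: mulr_ge0; [apply: mulr_ge0; [rewrite divr_ge0// ltW|exact: ltW]|exact: ltW].
  apply: le_trans (ler_wpM2l C0 (sum_inv_sqr_le J)).
  rewrite mulr_sumr; apply: ler_sum => j _.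
  have [far|_] := ltP rho2 (j%:R ^+ 2 / N); last first.
    by rewrite big1// mulr_ge0// invr_ge0 sqr_ge0.
  rewrite -mulr_sumr sum_tilted_weight.
  have jJ : (j <= J)%N by rewrite -ltnS.
  have ex := exponent_le S0 b c0 e0 Ne jJ coer far.
  have y0 : 0 < j%:R ^+ 2 / N by apply: lt_le_trans (ltW far); exact: lt_le_trans eps_rho.
  have Ni : 0 < N^-1 by rewrite invr_gt0.
  have j0 : 0 < j%:R ^+ 2 :> R by rewrite -(pmulr_lgt0 _ Ni).
  have := @tail_term_le R _ _ _ _ _ _ _ N0 c0 e0 Ne (le_trans eps_rho (ltW far)) erefl j0 ex.
  set T := expR _ => le1.
  have := ler_wpM2r (ltW Z0) le1.
  have -> : 16 / c ^+ 2 * eps * (j%:R ^+ 2)^-1 * Z = 16 / c ^+ 2 * eps * Z * (j%:R ^+ 2)^-1.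
    by ring.
  apply: le_trans; rewrite [X in _ * X]mulrC mulrA ler_wpM2l//.
    by rewrite mulr_ge0 ?expR_ge0// ltW.
  exact: field_partition_le.
have th3 : 0 < 3 / theta by exact: divr_gt0.
have E0 := expR_gt0 (8^-1 : R).
have tail2 : 3 / theta * expR 8^-1 * tail <=
    3 / theta * expR 8^-1 * (64 / c ^+ 2) * (eps * (1 + W)) * Z.
  have -> : 3 / theta * expR 8^-1 * (64 / c ^+ 2) * (eps * (1 + W)) * Z =
    3 / theta * expR 8^-1 * (64 / c ^+ 2 * (eps * (1 + W)) * Z) by ring.
  apply: ler_wpM2l; first by apply: mulr_ge0; exact: ltW.
  apply: le_trans tailE _; rewrite ler_pM2r// ler_wpM2l//.
  by rewrite divr_ge0// ltW.
have -> : susceptibility_const theta c * (eps * (1 + W)) * Z =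
   3 / theta * rho2 * Z + 3 / theta * expR 8^-1 * (64 / c ^+ 2) * (eps * (1 + W)) * Z.
  by rewrite /susceptibility_const /rho2 /K; ring.
by rewrite lerD2l.
Qed.

Lemma bounded_rv_fluctuation n (S : {set 'I_n}) x :
  @bounded_rv _ (n.-tuple (measurableTypeR R)) R (fluctuation mu theta S x).
Proof.
apply: bounded_rv_sum => i; apply: bounded_rvB; last exact: bounded_rv_cst.
apply: (@bounded_rv_tnth _ (measurableTypeR R) R (lncosh_shift theta x)).
exact: bounded_rv_lncosh_shift.
Qed.

Lemma bounded_rv_roughness n (S : {set 'I_n}) J :
  @bounded_rv _ (n.-tuple (measurableTypeR R)) R (roughness mu theta S J).
Proof.
have bc (a : R) : @bounded_rv _ (n.-tuple (measurableTypeR R)) R (fun=> a).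
  exact: bounded_rv_cst.
have bf x := bounded_rv_fluctuation S x.
apply: bounded_rv_sum => b; apply: bounded_rvD.
  by apply: bounded_rvM => //; exact: bounded_rvX.
apply: bounded_rvM => //; apply: bounded_rv_sum => l; apply: bounded_rvX.
by apply: bounded_rvD => //; apply: bounded_rvB => //; exact: bounded_rvM.
Qed.

(** Centring at most doubles the bound on the summands, which are then
    independent with mean zero. *)
Lemma expectation_centred_sqr n (S : {set 'I_n}) (g : R -> R) (B : R) :
  @bounded_rv _ (measurableTypeR R) R g -> (forall x, `|g x| <= B) ->
  \int[iid_law mu n]_h
     ((\sum_(i in S) (g (tnth h i) - \int[mu]_x g x)) ^+ 2) <=
  #|S|%:R * (2 * B) ^+ 2.
Proof.
move=> bg gB; set m := \int[mu]_x g x.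
have mB : `|m| <= B.
  rewrite ler_norml; apply: expectation_bounds => // x.
  by rewrite -ler_norml.
apply: (@expectation_iid_sum_sqr _ _ _ mu n S (fun x => g x - m)).
- by apply: bounded_rvB => //; exact: bounded_rv_cst.
- rewrite expectationB//; last exact: bounded_rv_cst.
  by rewrite expectation_cst subrr.
- by move=> x; rewrite (le_trans (ler_normB _ _))// mulr_natl mulr2n lerD.
Qed.

End susceptibility_assembled.

(** * Averaging over the field *)

Section divergence_bound.
Context {R : realType}.
Variables (mu : probability (measurableTypeR R) R) (theta : R).
Hypothesis theta_gt0 : 0 < theta.

Lemma gridS (N : R) b j : grid N b j.+1 = grid N b j + spin b / Num.sqrt N.
Proof. by rewrite /grid -natr1; ring. Qed.

(** The first step of the fluctuation on the grid is a centred sum with summands of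
    order [N^(-1/2)], and each of its [J <= X sqrt N] second differences one with
    summands of order [1/N]. *)
Lemma expectation_roughness n (S : {set 'I_n}) (J : nat) (X : R) :
  (0 < #|S|)%N -> theta <= #|S|%:R -> J%:R <= X * Num.sqrt #|S|%:R ->
  \int[iid_law mu n]_h roughness mu theta S J h <=
    16 * (theta + (X * (expR 2 * theta)) ^+ 2).
Proof.
move=> S0 thN JX; set N : R := #|S|%:R in thN JX *.
have N0 : 0 < N by rewrite ltr0n.
have sN0 : 0 < Num.sqrt N by rewrite sqrtr_gt0.
have sNK : Num.sqrt N ^+ 2 = N by rewrite sqr_sqrtr// ltW.
have st0 : 0 < Num.sqrt theta by rewrite sqrtr_gt0.
have stK : Num.sqrt theta ^+ 2 = theta by rewrite sqr_sqrtr// ltW.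
have bc (a : R) : @bounded_rv _ (n.-tuple (measurableTypeR R)) R (fun=> a).
  exact: bounded_rv_cst.
have bs x := bounded_rv_lncosh_shift theta x.
have bf x := bounded_rv_fluctuation mu theta S x.
have nspin b : `|spin b / Num.sqrt N| = (Num.sqrt N)^-1 :> R.
  by rewrite normrM spin_norm mul1r ger0_norm// invr_ge0 ltW.
have first b : \int[iid_law mu n]_h (fluctuation mu theta S (grid N b 1) h ^+ 2)
    <= 4 * theta.
  have := @expectation_centred_sqr R mu n S (lncosh_shift theta (grid N b 1))
    (Num.sqrt theta / Num.sqrt N) (bs _).
  move=> /(_ _)/le_trans; apply.
    move=> x; apply: le_trans (lncosh_shift_norm_le _ _ _) _.
    by rewrite /grid mulr1 nspin.
  rewrite -/N exprMn expr_div_n stK sNK.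
  by rewrite le_eqVlt; apply/orP; left; apply/eqP; field; rewrite gt_eqF.
pose sd b l h := fluctuation mu theta S (grid N b l.+2) h -
  2 * fluctuation mu theta S (grid N b l.+1) h + fluctuation mu theta S (grid N b l) h.
have bsd b l : @bounded_rv _ (n.-tuple (measurableTypeR R)) R (sd b l).
  by apply: bounded_rvD => //; apply: bounded_rvB => //; exact: bounded_rvM.
have second b l : \int[iid_law mu n]_h (sd b l h ^+ 2) <=
    4 * (expR 2 * theta) ^+ 2 / N.
  pose g x := lncosh_shift theta (grid N b l.+2) x -
    2 * lncosh_shift theta (grid N b l.+1) x + lncosh_shift theta (grid N b l) x.
  have bg2 : @bounded_rv _ (measurableTypeR R) R
      (fun x => 2 * lncosh_shift theta (grid N b l.+1) x).
    by apply: bounded_rvM => //; exact: bounded_rv_cst.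
  have bg1 : @bounded_rv _ (measurableTypeR R) R
      (fun x => lncosh_shift theta (grid N b l.+2) x -
        2 * lncosh_shift theta (grid N b l.+1) x).
    exact: bounded_rvB.
  have bg : @bounded_rv _ (measurableTypeR R) R g by exact: bounded_rvD.
  have gI : \int[mu]_x g x = Lambda mu theta (grid N b l.+2) -
      2 * Lambda mu theta (grid N b l.+1) + Lambda mu theta (grid N b l).
    by rewrite /g expectationD// expectationB// expectationZ.
  have sdE h : sd b l h = \sum_(i in S) (g (tnth h i) - \int[mu]_x g x).
    rewrite /sd /fluctuation mulr_sumr -sumrB -big_split/=.
    have alg (x x' y y' z z' : R) : x - x' - 2 * (y - y') + (z - z') =
      x - 2 * y + z - (x' - 2 * y' + z') by ring.
    by apply: eq_bigr => i _; rewrite gI /g; exact: alg.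
  under eq_Rintegral do rewrite sdE.
  have gB x : `|g x| <= expR 2 * theta / N.
    have := @lncosh_second_diff R (Num.sqrt theta * grid N b l.+1 + x)
      (Num.sqrt theta * (spin b / Num.sqrt N)).
    rewrite normrM nspin (ger0_norm (ltW st0)) ler_pdivrMr// mul1r ler_sqrt ?(ltW N0)//.
    move=> /(_ thN).
    have -> : (Num.sqrt theta * (spin b / Num.sqrt N)) ^+ 2 = theta / N.
      by rewrite exprMn stK expr_div_n spin_sqr sNK div1r.
    rewrite mulrA; congr (`|_| <= _).
    rewrite /g /lncosh_shift !gridS.
    set s := spin b / _.
    have -> : Num.sqrt theta * (grid N b l + s) + x + Num.sqrt theta * s =
      Num.sqrt theta * (grid N b l + s + s) + x by ring.
    have -> : Num.sqrt theta * (grid N b l + s) + x - Num.sqrt theta * s =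
      Num.sqrt theta * grid N b l + x by ring.
    ring.
  apply: le_trans (@expectation_centred_sqr R mu n S g _ bg gB) _.
  by rewrite -/N le_eqVlt; apply/orP; left; apply/eqP; field; rewrite gt_eqF.
have -> : 16 * (theta + (X * (expR 2 * theta)) ^+ 2) =
   \sum_(b : bool) (8 * theta + 8 * (X * (expR 2 * theta)) ^+ 2).
  by rewrite big_bool/=; ring.
rewrite /roughness -/N expectation_sum; last first.
  move=> b; apply: bounded_rvD; first by apply: bounded_rvM => //; exact: bounded_rvX.
  by apply: bounded_rvM => //; apply: bounded_rv_sum => l; exact: bounded_rvX (bsd b l).
apply: ler_sum => b _.
have bsum : @bounded_rv _ (n.-tuple (measurableTypeR R)) R
    (fun h => \sum_(l < J) sd b l h ^+ 2).
  by apply: bounded_rv_sum => l; exact: bounded_rvX.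
have bfx : @bounded_rv _ (n.-tuple (measurableTypeR R)) R
    (fun h => fluctuation mu theta S (grid N b 1) h ^+ 2) by exact: bounded_rvX.
rewrite expectationD; [|exact: bounded_rvM|exact: bounded_rvM].
have sumE : \int[iid_law mu n]_h (\sum_(l < J) sd b l h ^+ 2) =
    \sum_(l < J) \int[iid_law mu n]_h (sd b l h ^+ 2).
  apply: (@expectation_sum _ _ R (iid_law mu n) _ _ xpredT
    (fun (l : 'I_J) h => sd b l h ^+ 2)) => l.
  exact: (bounded_rvX 2 (bsd b l)).
rewrite !expectationZ//; apply: lerD; first by have := first b; lra.
rewrite -[X in _ * X <= _]/(\int[iid_law mu n]_h (\sum_(l < J) sd b l h ^+ 2)) sumE.
apply: (@le_trans _ _ (2 * J%:R * (\sum_(l < J) 4 * (expR 2 * theta) ^+ 2 / N))).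
  by apply: ler_wpM2l; [exact: mulr_ge0|apply: ler_sum => l _; exact: second].
rewrite sumr_const card_ord -[X in _ * X <= _]mulr_natl.
have -> : 2 * J%:R * (J%:R * (4 * (expR 2 * theta) ^+ 2 / N)) =
  8 * (J%:R * (expR 2 * theta) / Num.sqrt N) ^+ 2.
  by rewrite expr_div_n sNK; field; rewrite gt_eqF.
have et0 : 0 < expR 2 * theta by rewrite mulr_gt0// expR_gt0.
have q : J%:R * (expR 2 * theta) / Num.sqrt N <= X * (expR 2 * theta).
  by rewrite ler_pdivrMr// [leRHS]mulrAC ler_pM2r.
have q0 : 0 <= J%:R * (expR 2 * theta) / Num.sqrt N.
  by apply: divr_ge0; [apply: mulr_ge0 => //; exact: ltW|exact: ltW].
by rewrite ler_wpM2l// lerXn2r ?nnegrE// (le_trans q0).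
Qed.

(** The divergence between two planted laws that differ in a bounded number of
    sites is of the order of the mean squared magnetization, [eps] being the
    solution of [k eps^(2 tau - 1) = 1]. *)
Lemma kl_swap_susceptibility (t : nat) :
  (forall X : R, 0 < X -> exists2 c : R, 0 < c &
    forall x, `|x| <= X -> c * `|x| ^+ (2 * t.+1) <= x ^+ 2 / 2 - Lambda mu theta x) ->
  exists2 C : R, 0 < C & forall n (S S' : {set 'I_n}) (eps : R),
    #|S| = #|S'| -> (0 < #|S'|)%N -> (#|S :\: S'| <= 2)%N -> theta <= #|S'|%:R ->
    0 < eps -> #|S'|%:R * eps ^+ (2 * t).+1 = 1 ->
    kl (pRFCW mu theta S) (pRFCW mu theta S') <= C * eps.
Proof.
move=> coer; have st0 : 0 < Num.sqrt theta by rewrite sqrtr_gt0.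
(* The rescaled magnetization ranges over [- sqrt theta, sqrt theta]; rounding
   to the grid needs one more unit. *)
pose X := Num.sqrt theta + 1; have X0 : 0 < X by rewrite /X; lra.
have [c c0 Hc] := coer X X0.
pose Cs := susceptibility_const theta c.
have Cs0 : 0 < Cs by exact: susceptibility_const_gt0.
pose Cr := 16 * (theta + (X * (expR 2 * theta)) ^+ 2).
have Cr0 : 0 <= Cr by rewrite mulr_ge0// addr_ge0 ?sqr_ge0// ltW.
pose A := expR (16 * theta) * (32 * theta ^+ 2).
have A0 : 0 < A by rewrite mulr_gt0 ?expR_gt0// mulr_gt0// exprn_gt0.
exists (A * (Cs * (1 + Cr) + 4)).
  by rewrite mulr_gt0// addr_gt0// mulr_gt0//; lra.
move=> n S S' eps SS' S0 d2 thN e0 Ne; set N : R := #|S'|%:R in thN Ne.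
have N0 : 0 < N by rewrite ltr0n.
have N1 : 1 <= N by rewrite ler1n.
have sN1 : 1 <= Num.sqrt N by rewrite -sqrtr1 ler_sqrt.
pose J := (Num.truncn (Num.sqrt theta * Num.sqrt N)).+1.
have sp : 0 <= Num.sqrt theta * Num.sqrt N by rewrite mulr_ge0 ?sqrtr_ge0.
have /andP[J1 J2] := truncn_itv sp.
have JX : J%:R <= X * Num.sqrt N by rewrite /J -natr1 /X mulrDl mul1r lerD.
have coerJ x : `|x| * Num.sqrt N <= J%:R ->
    c * `|x| ^+ (2 * t.+1) <= x ^+ 2 / 2 - Lambda mu theta x.
  move=> /le_trans/(_ JX); rewrite ler_pM2r; last exact: lt_le_trans sN1.
  exact: Hc.
have e1 : eps <= 1.
  rewrite -(@expr_le1 _ (2 * t).+1) ?(ltW e0)// -Ne.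
  by rewrite ler_peMl// exprn_ge0// ltW.
have Ninv : N^-1 <= eps.
  have -> : N^-1 = eps ^+ (2 * t).+1 by rewrite -[LHS]mulr1 -Ne mulKf// gt_eqF.
  by rewrite exprSr ler_piMl ?(ltW e0) ?exprn_ile1 ?(ltW e0).
have bW := bounded_rv_roughness mu theta S' J.
have bc (a : R) : @bounded_rv _ (n.-tuple (measurableTypeR R)) R (fun=> a).
  exact: bounded_rv_cst.
have b1W : @bounded_rv _ (n.-tuple (measurableTypeR R)) R
  (fun h => 1 + roughness mu theta S' J h) by exact: bounded_rvD.
have be1W : @bounded_rv _ (n.-tuple (measurableTypeR R)) R
  (fun h => eps * (1 + roughness mu theta S' J h)) by exact: bounded_rvM.
have bV : @bounded_rv _ (n.-tuple (measurableTypeR R)) R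
  (fun h => Cs * (eps * (1 + roughness mu theta S' J h))) by exact: bounded_rvM.
apply: le_trans (kl_swap mu theta_gt0 SS' S0 d2 bV _) _.
  by move=> h; exact: (susceptibility_le theta_gt0 h S0 c0 e0 Ne J2 coerJ).
rewrite -/A -mulrA ler_pM2l// -/N [leRHS]mulrDl.
apply: lerD.
  rewrite !expectationZ// expectationD// expectation_cst -mulrA ler_pM2l//.
  by rewrite mulrC ler_pM2r// lerD2l; exact: expectation_roughness.
rewrite ler_wpM2l// -[eps]mulr1 -exprVn expr2.
by apply: ler_pM; rewrite ?invr_ge0 ?(ltW N0)// invf_le1.
Qed.

(** At every temperature the magnetization per site is at most one, so that a swap
    costs a bounded divergence. *)
Lemma kl_swap_bounded n (S S' : {set 'I_n}) :
  #|S| = #|S'| -> (0 < #|S'|)%N -> (#|S :\: S'| <= 2)%N ->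
  kl (pRFCW mu theta S) (pRFCW mu theta S') <=
    expR (16 * theta) * (32 * theta ^+ 2) * 5.
Proof.
move=> SS' S0 d2.
have N1 : 1 <= #|S'|%:R :> R by rewrite ler1n.
have N0 : 0 < #|S'|%:R :> R by rewrite ltr0n.
have b1 : @bounded_rv _ (n.-tuple (measurableTypeR R)) R (fun=> 1) by exact: bounded_rv_cst.
apply: le_trans (kl_swap mu theta_gt0 SS' S0 d2 b1 _) _.
  move=> h; have [g0 g1] := gibbs_is_pmf theta S' h; rewrite -[leRHS]g1.
  apply: ler_sum => s _; rewrite ler_piMr ?(ltW (g0 s))//.
  rewrite -[leLHS]real_normK ?num_real// expr_le1// normrM [`|_^-1|]ger0_norm ?invr_ge0//.
  by rewrite ler_pdivrMr// mul1r magnetization_norm_le.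
rewrite expectation_cst ler_pM2l; last first.
  by rewrite mulr_gt0 ?expR_gt0// mulr_gt0// exprn_gt0.
rewrite (_ : 5 = 1 + 4); last by ring.
rewrite lerD2l ler_pdivrMr ?exprn_gt0// ler_peMr//.
exact: exprn_ege1.
Qed.

End divergence_bound.

(** * Swap families and the minimax risk *)

Section swap_family.

Definition swaps (n : nat) (S0 : {set 'I_n}) (r : nat) : {set {set 'I_n}} :=
  [set S : {set 'I_n} | (#|S| == #|S0|) && (#|S :\: S0| == r)].

(** A swap is determined by the [r] removed and the [r] added sites. *)
Lemma card_swaps (n : nat) (S0 : {set 'I_n}) (r : nat) :
  ('C(#|S0|, r) * 'C(n - #|S0|, r) <= #|swaps S0 r|)%N.
Proof.
pose AA : {set {set 'I_n}} := [set A : {set 'I_n} | (A \subset S0) && (#|A| == r)]%SET.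
pose BB : {set {set 'I_n}} := [set B : {set 'I_n} | (B \subset ~: S0) && (#|B| == r)]%SET.
have <- : #|finset.setX AA BB| = ('C(#|S0|, r) * 'C(n - #|S0|, r))%N.
  rewrite cardsX !cards_draws; congr (_ * 'C(_, _))%N.
  by rewrite cardsCs finset.setCK card_ord.
pose f (p : {set 'I_n} * {set 'I_n}) := (S0 :\: p.1) :|: p.2.
have sub p : p \in finset.setX AA BB ->
    [/\ p.1 \subset S0, p.2 \subset ~: S0, #|p.1| = r & #|p.2| = r].
  by case: p => A B; rewrite !inE /= => /andP[/andP[? /eqP ?] /andP[? /eqP ?]].
have fD p : p \in finset.setX AA BB -> f p :\: S0 = p.2 /\ S0 :\: f p = p.1.
  move=> /sub[A B _ _]; split; apply/finset.setP => i; rewrite !inE.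
    have := fintype.subsetP B i; rewrite inE.
    by case: (i \in p.2) => [/(_ isT) ->|_]; case: (i \in S0); rewrite ?andbF ?orbT.
  have := fintype.subsetP B i; have := fintype.subsetP A i; rewrite inE.
  case: (i \in p.1) => [/(_ isT) ->|_]; case: (i \in p.2) => //=.
  - by move=> /(_ isT).
  - by move=> /(_ isT) /negbTE ->.
  - by case: (i \in S0).
rewrite -(card_in_imset (f := f)).
  apply/subset_leq_card/fintype.subsetP => S /imsetP[p pI ->]; rewrite inE.
  have [fB fA] := fD p pI; have [A B cA cB] := sub p pI.
  rewrite fB cB eqxx andbT -(cardsID S0 (f p)) -[X in _ == X](cardsID (f p) S0).
  by rewrite fB fA cA cB finset.setIC.
move=> p q pI qI E; have [p2 p1] := fD p pI; have [q2 q1] := fD q qI.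
by rewrite [p]surjective_pairing [q]surjective_pairing -p1 -p2 E q1 q2.
Qed.

End swap_family.

Section minimax.
Context {R : realType}.
Variables (mu : probability (measurableTypeR R) R) (theta : R).

Lemma error_prob_le1 k n m (q : {ffun {set 'I_n} -> R}) (est : estimator m n) :
  is_prior k q -> error_prob mu theta q est <= 1.
Proof.
move=> [q0 _ q1]; rewrite -q1; apply: ler_sum => S _.
rewrite /joint_law -mulr_sumr ler_piMr//.
have [P0 P1] := iid_pmf_is_pmf m (pRFCW_is_pmf mu theta S).
rewrite -[leRHS]P1 [leRHS](bigID (fun x => S != est x))/= lerDl.
by apply: sumr_ge0 => x _; exact: ltW.
Qed.

Lemma minimax_risk_ge k n m (b : R) :
  (forall est : estimator m n, exists2 q, is_prior k q & b <= error_prob mu theta q est) ->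
  b <= minimax_risk mu theta k n m.
Proof.
move=> H; apply: lb_le_inf.
  by exists (sup [set error_prob mu theta q (fun _ : sample m n => finset.set0) | q in @is_prior R k n]), (fun=> finset.set0).
move=> _ [est _ <-]; have [q qP bq] := H est.
apply: le_trans bq _; apply: ub_le_sup; last by exists q.
by exists 1 => _ [q' q'P <-]; exact: error_prob_le1 q'P.
Qed.

Definition uniform_prior n (F : {set {set 'I_n}}) : {ffun {set 'I_n} -> R} :=
  [ffun S => if S \in F then #|F|%:R^-1 else 0].

Lemma uniform_prior_is_prior k n (F : {set {set 'I_n}}) : (0 < #|F|)%N ->
  (forall S, S \in F -> #|S| = k) -> is_prior k (uniform_prior F).
Proof.
move=> F0 Fk; split.
- by move=> S; rewrite ffunE; case: ifP => // _; rewrite invr_ge0.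
- by move=> S Sk; rewrite ffunE; case: ifP => // /Fk SE; rewrite SE eqxx in Sk.
- under eq_bigr do rewrite ffunE.
  rewrite -big_mkcond sumr_const -[LHS]mulr_natl divff// pnatr_eq0 -lt0n//.
Qed.

Lemma error_prob_uniform n m (F : {set {set 'I_n}}) (est : estimator m n) :
  (0 < #|F|)%N ->
  error_prob mu theta (uniform_prior F) est =
  1 - #|F|%:R^-1 * (\sum_(S in F) \sum_(x | est x == S) iid_pmf (pRFCW mu theta S) x).
Proof.
move=> F0; have Fn : #|F|%:R != 0 :> R by rewrite pnatr_eq0 -lt0n.
have E1 : #|F|%:R^-1 * \sum_(S in F) (1 : R) = 1.
  by rewrite sumr_const mulVf.
rewrite -[X in _ = X - _]E1 -mulrBr -sumrB mulr_sumr /error_prob [RHS]big_mkcond; apply: eq_bigr => S _.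
rewrite /joint_law -mulr_sumr ffunE; case: ifP => _; last by rewrite mul0r.
congr (_ * _); have [_ P1] := iid_pmf_is_pmf m (pRFCW_is_pmf mu theta S).
rewrite -[X in _ = X - _]P1 [X in _ = X - _](bigID (fun x => est x == S))/= addrAC subrr add0r.
by apply: eq_bigl => x; rewrite eq_sym.
Qed.

(** The multiplier [lam = ln n / 2] makes the exponential term [sqrt n / #|F|]. *)
Lemma minimax_risk_fano n m (S0 : {set 'I_n}) (F : {set {set 'I_n}}) (C1 C2 eps : R) :
  (1 < n)%N -> (0 < m)%N -> (0 < #|F|)%N ->
  (forall S, S \in F -> #|S| = #|S0| /\
     kl (pRFCW mu theta S) (pRFCW mu theta S0) <= C1 * eps) ->
  0 <= C2 * eps -> Num.sqrt n%:R / #|F|%:R <= C2 * eps ->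
  minimax_risk mu theta #|S0| n m >= 1 - 2 * (C1 + C2) * (m%:R * eps / ln n%:R).
Proof.
move=> n1 m0 F0 HF C2e HC2; have n1R : 1 < n%:R :> R by rewrite ltr1n.
have ln0 : 0 < ln n%:R :> R by exact: ln_gt0.
have n0 : 0 < n%:R :> R by rewrite ltr0n ltnW.
have m1 : 1 <= m%:R :> R by rewrite ler1n.
apply: minimax_risk_ge => est; exists (uniform_prior F).
  by apply: uniform_prior_is_prior => // S /HF[].
rewrite error_prob_uniform// lerD2l lerN2.
pose lam : R := ln n%:R / 2; have lam0 : 0 < lam by rewrite divr_gt0.
have elam : expR lam = Num.sqrt n%:R.
  have h : expR lam ^+ 2 = n%:R.
    have lnn : expR (ln n%:R) = n%:R :> R by rewrite lnK ?posrE.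
    by rewrite expr2 -expRD -lnn /lam; congr expR; field.
  by rewrite -h sqrtr_sqr ger0_norm ?expR_ge0.
have fs := @fano_success R (config n) _ m (pRFCW mu theta (n := n)) F S0 (C1 * eps) lam
  est (pRFCW_is_pmf mu theta (n := n)) F0 lam0 (fun S SF => (HF S SF).2).
apply: le_trans fs _.
rewrite elam ler_pdivrMr//.
have -> : 2 * (C1 + C2) * (m%:R * eps / ln n%:R) * lam = m%:R * (C1 * eps) + m%:R * (C2 * eps).
  by rewrite /lam; field; rewrite gt_eqF.
by rewrite lerD2l (le_trans HC2)// ler_peMl.
Qed.

End minimax.

(** * Conclusion *)

Lemma exists_card_set (n k : nat) : (k <= n)%N -> exists S0 : {set 'I_n}, #|S0| = k.
Proof.
move=> kn; exists [set widen_ord kn x | x in [set: 'I_k]]%SET.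
rewrite card_imset ?cardsT ?card_ord// => x y /(congr1 val)/= xy; exact: val_inj.
Qed.

Lemma bin2_mul2 (n : nat) : ('C(n, 2) * 2 = n * n.-1)%N.
Proof. by rewrite -[2%N in LHS]/(2`!) bin_ffact ffactnS ffactn1. Qed.

Lemma card_swaps2_ge (n : nat) (S0 : {set 'I_n}) : (2 <= #|S0|)%N -> (#|S0|.+1 < n)%N ->
  (#|S0| * n <= 8 * #|swaps S0 2|)%N.
Proof.
move=> k2 kn; have H := card_swaps S0 2.
have key (k q f : nat) : (2 <= k)%N -> (2 <= q)%N ->
    ('C(k, 2) * 'C(q, 2) <= f)%N -> (k * (k + q) <= 8 * f)%N.
  have := bin2_mul2 k; have := bin2_mul2 q.
  case: k => [|[|k]]//; case: q => [|[|q]]//=; nia.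
rewrite -[X in (_ * X <= _)%N](@subnKC #|S0|); last by rewrite ltnW// ltnW.
by apply: key H => //; rewrite ltn_subRL addn1.
Qed.

Lemma card_swaps1_ge (n : nat) (S0 : {set 'I_n}) : (0 < #|S0|)%N -> (#|S0| < n)%N ->
  (n <= 2 * #|swaps S0 1|)%N.
Proof.
move=> k0 kn; have := card_swaps S0 1; rewrite !bin1; nia.
Qed.

Section conclusion.
Context {R : realType}.
Variables (mu : probability (measurableTypeR R) R) (theta : R).
Hypothesis theta_gt0 : 0 < theta.

(** When [k] is close to [n] a single swap only produces about [n] hypotheses, and a
    blind guess among them succeeds with probability of order [1 / k], more than
    the [1 / (k ln n)] aimed at; two swaps produce at least [k n / 8]. *)
Lemma minimax_two_swaps (C1 : R) n m (S0 : {set 'I_n}) :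
  0 <= C1 -> (2 <= #|S0|)%N -> (#|S0|.+1 < n)%N -> (0 < m)%N ->
  (forall S : {set 'I_n}, #|S| = #|S0| -> (#|S :\: S0| <= 2)%N ->
     kl (pRFCW mu theta S) (pRFCW mu theta S0) <= C1 * #|S0|%:R^-1) ->
  minimax_risk mu theta #|S0| n m >= 1 - 2 * (C1 + 8) * (m%:R * #|S0|%:R^-1 / ln n%:R).
Proof.
move=> C10 k2 kn m0 Hkl; have F8 := card_swaps2_ge k2 kn.
have n1 : (1 < n)%N by exact: leq_trans kn.
have k0 : 0 < #|S0|%:R :> R by rewrite ltr0n ltnW.
have n1R : 1 <= n%:R :> R by rewrite ler1n ltnW.
have F0 : (0 < #|swaps S0 2|)%N.
  have : (0 < #|S0| * n)%N by rewrite muln_gt0 ltnW//= ltnW.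
  by move=> /leq_trans/(_ F8); rewrite muln_gt0 => /andP[].
apply: (@minimax_risk_fano R mu theta n m S0 (swaps S0 2) C1 8) => //.
  by move=> S; rewrite inE => /andP[/eqP Sk /eqP S2]; split; rewrite ?Hkl ?S2.
rewrite ler_pdivrMr ?ltr0n// mulrAC ler_pdivlMr// -natrM.
apply: (@le_trans _ _ (n%:R * #|S0|%:R)); last by rewrite -natrM ler_nat mulnC.
have s1 : 1 <= Num.sqrt n%:R :> R by rewrite -[leLHS]sqrtr1 ler_sqrt// (le_trans ler01).
rewrite ler_pM2r// -[leRHS]sqr_sqrtr ?(le_trans ler01)//.
by rewrite expr2 ler_peMr ?sqrtr_ge0.
Qed.

(** The family has at least [n / 2] members, hence [sqrt n / #|F| <= 2 / sqrt n],
    which is at most [2 eps] as [1 / k <= eps^2]. *)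
Lemma minimax_one_swap (C1 eps : R) n m (S0 : {set 'I_n}) :
  0 <= C1 -> (0 < #|S0|)%N -> (#|S0| < n)%N -> (0 < m)%N ->
  0 <= eps -> #|S0|%:R^-1 <= eps ^+ 2 ->
  (forall S : {set 'I_n}, #|S| = #|S0| -> (#|S :\: S0| <= 2)%N ->
     kl (pRFCW mu theta S) (pRFCW mu theta S0) <= C1 * eps) ->
  minimax_risk mu theta #|S0| n m >= 1 - 2 * (C1 + 2) * (m%:R * eps / ln n%:R).
Proof.
move=> C10 k1 kn m0 e0 ke Hkl; have F2 := card_swaps1_ge k1 kn.
have n1 : (1 < n)%N by exact: leq_ltn_trans kn.
have k0 : 0 < #|S0|%:R :> R by rewrite ltr0n.
have n0 : 0 < n%:R :> R by rewrite ltr0n ltnW.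
have sn0 : 0 < Num.sqrt n%:R :> R by rewrite sqrtr_gt0.
have F0 : (0 < #|swaps S0 1|)%N.
  by have := leq_trans (ltnW n1) F2; rewrite muln_gt0 => /andP[].
apply: (@minimax_risk_fano R mu theta n m S0 (swaps S0 1) C1 2) => //.
- by move=> S; rewrite inE => /andP[/eqP Sk /eqP S2]; split; rewrite ?Hkl ?S2.
- by rewrite mulr_ge0.
have sne : (Num.sqrt n%:R)^-1 <= eps.
  rewrite -ler_sqr ?nnegrE ?invr_ge0 ?sqrtr_ge0// exprVn sqr_sqrtr ?(ltW n0)//.
  by apply: le_trans ke; rewrite lef_pV2 ?posrE// ler_nat ltnW.
rewrite ler_pdivrMr ?ltr0n//.
have nF : n%:R <= 2 * #|swaps S0 1|%:R :> R by rewrite -natrM ler_nat.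
have inv0 : 0 <= (Num.sqrt n%:R)^-1 :> R by rewrite invr_ge0 ltW.
have := ler_pM (ltW n0) inv0 nF sne.
have -> : n%:R * (Num.sqrt n%:R)^-1 = Num.sqrt n%:R :> R.
  have E := sqr_sqrtr (ltW n0).
  by rewrite -[X in X * _]E expr2 mulfK// gt_eqF.
lra.
Qed.

End conclusion.

Theorem theorem3p8 (R : realType) (mu : probability (measurableTypeR R) R)
    (theta1 : R)
    (h_integrable : mu.-integrable [set: measurableTypeR R] (fun h => h%:E))
    (theta1_gt0 : 0 < theta1)
    (E_tanh : \int[mu]_h tanh h = 0) :
  [/\ theta1 < 1 / \int[mu]_h (sech h ^+ 2) ->
      is_global_min (Hfun mu theta1) 0 ->
      exists2 C : R, 0 < C & \forall k \near \oo, forall n m : nat,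
        (k.+1 < n)%N -> (0 < m)%N ->
        minimax_risk mu theta1 k n m >= 1 - C * (m%:R / (k%:R * ln n%:R)),
      theta1 > 1 / \int[mu]_h (sech h ^+ 2) ->
      exists2 C : R, 0 < C & \forall k \near \oo, forall n m : nat,
        (k < n)%N -> (0 < m)%N ->
        minimax_risk mu theta1 k n m >= 1 - C * (m%:R / ln n%:R) &
      theta1 = 1 / \int[mu]_h (sech h ^+ 2) ->
      is_global_min (Hfun mu theta1) 0 ->
      forall tau : nat, flat_local_min (Hfun mu theta1) 0 tau ->
      exists2 C : R, 0 < C & \forall k \near \oo, forall n m : nat,
        (k < n)%N -> (0 < m)%N ->
        minimax_risk mu theta1 k n m >=
          1 - C * (m%:R / (k%:R `^ (2 * tau%:R - 1)^-1 * ln n%:R))].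
Proof.
have near_theta : \forall k \near \oo, (2 <= k)%N /\ theta1 <= k%:R.
  near=> k; split; first by near: k; exact: nbhs_infty_ge.
  near: k; exact: nbhs_infty_ger.
split.
- move=> high gm; have pos := global_min_Lambda h_integrable gm.
  have [C1 C10 HC] := kl_swap_susceptibility (t := 0%N) theta1_gt0
    (coercive_extend pos (local_curvature_high_temp theta1_gt0 E_tanh high)).
  exists (2 * (C1 + 8)); first by rewrite mulr_gt0// addr_gt0.
  near=> k => n m kn m0.
  have [k2 thk] : (2 <= k)%N /\ theta1 <= k%:R by near: k.
  have [S0 S0k] : exists S0 : {set 'I_n}, #|S0| = k.
    by apply: exists_card_set; rewrite ltnW// ltnW.
  subst k; have k0 : 0 < #|S0|%:R :> R by rewrite ltr0n ltnW.
  rewrite invfM [m%:R * _]mulrA; apply: minimax_two_swaps => //; first exact: ltW.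
  move=> S SS0 d2; apply: HC => //; rewrite ?invr_gt0 ?(ltnW k2)//.
  by rewrite muln0 expr1 divff// gt_eqF.
- move=> _; pose C1 := expR (16 * theta1) * (32 * theta1 ^+ 2) * 5.
  have C10 : 0 < C1 by rewrite !mulr_gt0 ?expR_gt0 ?exprn_gt0.
  exists (2 * (C1 + 2)); first by rewrite mulr_gt0// addr_gt0.
  near=> k => n m kn m0.
  have [k2 _] : (2 <= k)%N /\ theta1 <= k%:R by near: k.
  have [S0 S0k] := exists_card_set (ltnW kn); subst k.
  rewrite -[m%:R]mulr1; apply: minimax_one_swap => //.
  + exact: ltW.
  + exact: ltnW.
  + by rewrite expr1n invf_le1 ?ltr0n ?ler1n ltnW.
  by move=> S SS0 d2; rewrite mulr1; apply: kl_swap_bounded => //; exact: ltnW.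
- move=> _ gm tau flat; have pos := global_min_Lambda h_integrable gm.
  have [tau2 _ _ _] := flat.
  case: tau tau2 flat => [//|t] t1 flat.
  have [C1 C10 HC] := kl_swap_susceptibility (t := t) theta1_gt0
    (coercive_extend pos (local_curvature_flat h_integrable flat)).
  exists (2 * (C1 + 2)); first by rewrite mulr_gt0// addr_gt0.
  near=> k => n m kn m0.
  have [k2 thk] : (2 <= k)%N /\ theta1 <= k%:R by near: k.
  have [S0 S0k] := exists_card_set (ltnW kn); subst k.
  have k0 : 0 < #|S0|%:R :> R by rewrite ltr0n ltnW.
  set a := #|S0|%:R `^ _; have a0 : 0 < a by exact: powR_gt0.
  have ap : a ^+ (2 * t).+1 = #|S0|%:R.
    rewrite -powR_mulrn ?(ltW a0)// /a -powRrM.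
    have -> : 2 * t.+1%:R - 1 = (2 * t).+1%:R :> R.
      by rewrite -(natr1 (2 * t)) natrM -(natr1 t); ring.
    by rewrite mulVf ?powRr1 ?(ltW k0)// pnatr_eq0.
  have ke : #|S0|%:R * a^-1 ^+ (2 * t).+1 = 1.
    by rewrite exprVn ap divff// gt_eqF.
  have a1 : a^-1 <= 1.
    rewrite -(@expr_le1 _ (2 * t).+1) ?invr_ge0 ?(ltW a0)// exprVn ap invf_le1//.
    by rewrite ler1n ltnW.
  rewrite invfM [m%:R * _]mulrA; apply: minimax_one_swap => //.
  + exact: ltW.
  + exact: ltnW.
  + by rewrite invr_ge0 ltW.
  + rewrite -ap -exprVn; apply: ler_wiXn2l => //; first by rewrite invr_ge0 ltW.
    by lia.
  by move=> S SS0 d2; apply: HC => //; rewrite ?invr_gt0// ltnW.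
Unshelve. all: by end_near. Qed.
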